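(* Let $A$ be a split graded pseudo-Frobenius algebra and $(e_i)_{i\in I}$ a weakly basic distinguished family of orthogonal idempotents, and let $\nu:I\to I$ be the Nakayama permutation of $A$. The following assertions hold: 1. If $i\in I$ and $h_i\in\mathrm{Supp}(e_i\mathrm{Soc}_{gr}(A))$, then $\dim_K(e_i\mathrm{Soc}_{gr}(A)_{h_i})=1$. 2. For a bilinear form $(-,-):A\times A\longrightarrow K$, the following statements are equivalent: (a) $(-,-)$ is a graded Nakayama form for $A$. (b) There exist an element $\mathbf h=(h_i)\in\prod_{i\in I}\mathrm{Supp}(e_i\mathrm{Soc}_{gr}(A))$ and a basis $\mathcal B_i$ of $e_iA_{h_i}e_{\nu(i)}$, for each $i\in I$, such that: (i) $\mathcal B_i$ contains a (unique) element $w_i$ of $e_i\mathrm{Soc}_{gr}(A)_{h_i}$, for each $i\in I$; (ii) for all $i,j\in I$ and $h,k\in H$, $(e_iA_h,A_ke_j)=0$ unless $j=\nu(i)$ and $h+k=h_i$; (iii) if $(a,b)\in e_iA_h\times A_{h_i-h}e_{\nu(i)}$ (with $i\in I$, $h\in H$), then the value $(a,b)\in K$ of the form is the coefficient of $w_i$ in the expression of $ab$ as a linear combination of the elements of $\mathcal B_i$.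
   Context: $K$ is a fixed field and $H$ a fixed abelian group, written additively. Algebras are associative $K$-algebras, not necessarily unital. A *graded algebra with enough idempotents* is an $H$-graded algebra $A=\oplus_{h\in H}A_h$ having a family $(e_i)_{i\in I}$ of nonzero orthogonal idempotents, homogeneous of degree $0$, with $\oplus_{i\in I}e_iA=A=\oplus_{i\in I}Ae_i$ (a *distinguished family* ). $A$ is *locally finite dimensional* if $\dim_K e_iA_he_j<\infty$ for all $i,j\in I$, $h\in H$. Modules are unital; $A\text{-}Gr$ (resp. $Gr\text{-}A$) is the category of $H$-graded left (resp. right) $A$-modules with degree $0$ homomorphisms. The graded Jacobson radical $J^{gr}(A)$ is the intersection of all maximal graded left ideals of $A$ (equivalently, of all maximal graded right ideals). A locally finite dimensional graded algebra with enough idempotents is *weakly basic* if it has a distinguished family $(e_i)_{i\in I}$ (called *weakly basic* ) such that each $e_iA_0e_i$ is local and $e_iAe_j\subseteq J^{gr}(A)$ for all $i\neq j$. It is *split* if $e_iA_0e_i/e_iJ(A_0)e_i\cong K$ for each $i$, where $J(A_0)$ is the Jacobson radical of $A_0$. For graded $K$-vector spaces $V,W$ with finite dimensional homogeneous components, put $D(V)=\oplus_h\mathrm{Hom}_K(V_h,K)$. A bilinear form $V\times W\to K$ is *of degree $d\in H$* if $(V_h,W_k)\neq 0$ implies $h+k=d$; such a form is *nondegenerate* if the induced maps $W\to D(V)$ and $V\to D(W)$ are bijective. A *graded Nakayama form* for a weakly basic $A$ is a bilinear form $(-,-):A\times A\to K$ such that: (i) $(ab,c)=(a,bc)$ for all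 $a,b,c\in A$; (ii) for each $i\in I$ there is a unique $\nu(i)\in I$ with $(e_iA,Ae_{\nu(i)})\neq 0$, and $\nu:I\to I$ is a bijection (the *Nakayama permutation* ); (iii) there is a map $\mathbf h:I\to H$ (the *degree map* ) such that, for all $i,j\in I$, the induced form $e_iAe_j\times e_jAe_{\nu(i)}\to K$ is a nondegenerate graded bilinear form of degree $\mathbf h(i)$. A graded algebra is *graded pseudo-Frobenius* if it is weakly basic (in particular locally finite dimensional) and admits a graded Nakayama form; equivalently, if it is weakly basic and in $A\text{-}Gr$ (resp. $Gr\text{-}A$) the finitely generated projective objects coincide with the finitely cogenerated injective ones. For such an $A$ the graded socles of $A$ as a left and as a right graded module coincide; the common ideal is $\mathrm{Soc}_{gr}(A)$. All graded Nakayama forms for $A$ have the same Nakayama permutation: $\nu(i)$ is the unique element of $I$ with $e_i\mathrm{Soc}_{gr}(A)e_{\nu(i)}\neq0$. The support of a graded vector space $V=\oplus_hV_h$ is $\mathrm{Supp}(V)=\{h\in H:V_h\neq0\}$. *)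

(* Defs.v *)
From mathcomp Require Import all_boot all_order all_algebra.
From mathcomp Require Import sesquilinear.
From mathcomp Require Import boolp classical_sets functions cardinality fsbigop.

Set Implicit Arguments.
Unset Strict Implicit.
Unset Printing Implicit Defensive.

Import GRing.Theory.

Local Open Scope classical_set_scope.
Local Open Scope ring_scope.

Section Subspaces.
Context {K : fieldType} {V : lmodType K}.
Implicit Types U W : set V.

Definition subspace U : Prop :=
  U 0 /\ forall (c : K) x y, U x -> U y -> U (c *: x + y).

Definition nonzero_set U : Prop := exists2 x, U x & x <> 0.

(* The internal direct sum of the [F i] is the whole space. *)
Definition direct_sum_decomposition {I : choiceType} (F : I -> set V) : Prop :=
  forall x : V, exists! v : I -> V,
    [/\ forall i, F i (v i),
        finite_set [set i | v i <> 0]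
      & x = \sum_(i \in [set: I]) v i].

Definition is_basis U (B : seq V) : Prop :=
  [/\ uniq B,
      forall x, U x <-> exists c : V -> K, x = \sum_(b <- B) c b *: b
    & forall c : V -> K, \sum_(b <- B) c b *: b = 0 ->
        forall b, b \in B -> c b = 0].

Definition has_dim U (n : nat) : Prop :=
  exists2 B : seq V, is_basis U B & size B = n.

Definition finite_dim U : Prop := exists n, has_dim U n.

(* For [w \in B] with [B] linearly independent: [x] lies in the span of [B]
   and [k] is the coefficient of [w] in its expression. *)
Definition is_coefficient (B : seq V) (w x : V) (k : K) : Prop :=
  exists2 c : V -> K, x = \sum_(b <- B) c b *: b & k = c w.

End Subspaces.

(* The carrier need not have a unit, so that MathComp's [algType] does not
   apply; bilinearity of the product carries distributivity. *)
Record graded_algebra (K : fieldType) (H : zmodType) := GradedAlgebra {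
  gr_sort :> lmodType K;
  gr_mul : {bilinear gr_sort -> gr_sort -> gr_sort};
  gr_mulA : associative gr_mul;
  gr_comp : H -> set gr_sort;
  gr_comp_subspace : forall h, subspace (gr_comp h);
  gr_comp_direct : direct_sum_decomposition gr_comp;
  gr_comp_mul : forall h k x y,
    gr_comp h x -> gr_comp k y -> gr_comp (h + k) (gr_mul x y)
}.

Arguments gr_mul {K H} g.
Arguments gr_comp {K H} g h.

Section GradedAlgebras.
Context {K : fieldType} {H : zmodType}.
Variable A : graded_algebra K H.
Implicit Types (e x y : A) (S L U W : set A).

Local Notation "x ** y" := (gr_mul A x y) (at level 40, left associativity).
Local Notation "A_[ h ]" := (gr_comp A h) (format "A_[ h ]").

(* eU, Ue and eUe' *)
Definition mulset_l e U : set A := [set e ** x | x in U].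
Definition mulset_r U e : set A := [set x ** e | x in U].
Definition corner e U e' : set A := mulset_r (mulset_l e U) e'.

Definition degree_part U (h : H) : set A := U `&` A_[h].

Definition gr_support U : set H := [set h | nonzero_set (degree_part U h)].

Definition graded_subspace U : Prop :=
  subspace U /\
  forall x, U x -> exists v : H -> A,
    [/\ forall h, degree_part U h (v h),
        finite_set [set h | v h <> 0]
      & x = \sum_(h \in [set: H]) v h].

(* [S] is intended to be a subalgebra of [A], with its own unit or with
   enough idempotents. *)
Definition left_ideal_of S L : Prop :=
  [/\ subspace L, L `<=` S & forall s x, S s -> L x -> L (s ** x)].

Definition maximal_left_ideal_of S L : Prop :=
  [/\ left_ideal_of S L, L <> S
    & forall L', left_ideal_of S L' -> L `<=` L' -> L' <> S -> L' = L].

Definition local_algebra S : Prop := exists! L, maximal_left_ideal_of S L.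

Definition jacobson_radical S : set A :=
  [set x | S x /\ forall L, maximal_left_ideal_of S L -> L x].

Definition graded_left_ideal L : Prop :=
  left_ideal_of [set: A] L /\ graded_subspace L.

Definition maximal_graded_left_ideal L : Prop :=
  [/\ graded_left_ideal L, L <> [set: A]
    & forall L', graded_left_ideal L' -> L `<=` L' -> L' <> [set: A] ->
        L' = L].

Definition simple_graded_left_ideal L : Prop :=
  [/\ graded_left_ideal L, L <> [set 0]
    & forall L', graded_left_ideal L' -> L' `<=` L -> L' <> [set 0] ->
        L' = L].

Definition graded_jacobson_radical : set A :=
  [set x | forall L, maximal_graded_left_ideal L -> L x].

(* The socle of [A] as a graded left module: the sum of its simple graded
   submodules.  For graded pseudo-Frobenius algebras the right socle is the
   same. *)
Definition graded_socle : set A :=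
  [set x | exists2 s : seq A,
     (forall y, y \in s -> exists2 L, simple_graded_left_ideal L & L y)
   & x = \sum_(y <- s) y].

Definition distinguished_family {I : choiceType} (e : I -> A) : Prop :=
  [/\ forall i, [/\ e i <> 0, e i ** e i = e i & A_[0] (e i)],
      forall i j, i <> j -> e i ** e j = 0,
      direct_sum_decomposition (fun i => mulset_l (e i) [set: A])
    & direct_sum_decomposition (fun i => mulset_r [set: A] (e i))].

Definition locally_finite_dim {I : choiceType} (e : I -> A) : Prop :=
  forall i j h, finite_dim (corner (e i) A_[h] (e j)).

Definition weakly_basic_family {I : choiceType} (e : I -> A) : Prop :=
  [/\ distinguished_family e,
      locally_finite_dim e,
      forall i, local_algebra (corner (e i) A_[0] (e i))
    & forall i j, i <> j ->
        corner (e i) [set: A] (e j) `<=` graded_jacobson_radical].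

(* An isomorphism of algebras from eA_0e / eJ(A_0)e to K, given as a map on
   eA_0e that is injective modulo eJ(A_0)e. *)
Definition residue_iso e (phi : A -> K) : Prop :=
  let S := corner e A_[0] e in
  let J := corner e (jacobson_radical A_[0]) e in
  [/\ forall x y, S x -> S y -> phi x = phi y <-> J (x - y),
      forall k, exists2 x, S x & phi x = k,
      forall c x y, S x -> S y -> phi (c *: x + y) = c * phi x + phi y,
      forall x y, S x -> S y -> phi (x ** y) = phi x * phi y
    & phi e = 1].

(* Being split, like being pseudo-Frobenius below, is a property of the
   algebra: it refers to some weakly basic family. *)
Definition split_algebra : Prop :=
  exists (I : choiceType) (e : I -> A),
    weakly_basic_family e /\ forall i, exists phi, residue_iso (e i) phi.

Implicit Type form : A -> A -> K.

Definition form_nonzero form U W : Prop :=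
  exists x y, [/\ U x, W y & form x y <> 0].

Definition form_of_degree form U W (d : H) : Prop :=
  forall h k x y, degree_part U h x -> degree_part W k y ->
    form x y <> 0 -> h + k = d.

(* Elements of D(U), the sum over h of the Hom_K(U_h, K), seen as linear
   functionals on the graded subspace [U] that vanish on all but finitely many
   [U_h].  Only the values of [f] on [U] are meaningful. *)
Definition graded_dual U (f : A -> K) : Prop :=
  (forall c x y, U x -> U y -> f (c *: x + y) = c * f x + f y) /\
  finite_set [set h | exists2 x, degree_part U h x & f x <> 0].

(* [y |-> form _ y] is a bijection from [W] onto D(U). *)
Definition induces_bijection form U W : Prop :=
  (forall y, W y -> graded_dual U (form^~ y)) /\
  forall f, graded_dual U f ->
    exists! y, W y /\ forall x, U x -> form x y = f x.

Definition form_nondegenerate form U W : Prop :=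
  induces_bijection form U W /\ induces_bijection (fun y x => form x y) W U.

Definition graded_nakayama_form_with {I : choiceType} (e : I -> A)
    (nu : I -> I) form : Prop :=
  [/\ forall a b c, form (a ** b) c = form a (b ** c),
      forall i j, form_nonzero form (mulset_l (e i) [set: A])
                                    (mulset_r [set: A] (e j)) <-> j = nu i,
      bijective nu
    & exists hh : I -> H, forall i j,
        let U := corner (e i) [set: A] (e j) in
        let W := corner (e j) [set: A] (e (nu i)) in
        form_of_degree form U W (hh i) /\ form_nondegenerate form U W].

Definition graded_nakayama_form {I : choiceType} (e : I -> A) form : Prop :=
  exists nu : I -> I, graded_nakayama_form_with e nu form.

Definition graded_pseudo_frobenius : Prop :=
  exists (I : choiceType) (e : I -> A),
    weakly_basic_family e /\
    exists form : {biscalar A}, graded_nakayama_form e form.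

(* All graded Nakayama forms with respect to [e] have the same permutation. *)
Definition nakayama_permutation {I : choiceType} (e : I -> A)
    (nu : I -> I) : Prop :=
  exists form : {biscalar A}, graded_nakayama_form_with e nu form.

End GradedAlgebras.

Arguments graded_jacobson_radical {K H} A.
Arguments graded_socle {K H} A.

(* Main.v *)
Require Import Defs.
From mathcomp Require Import all_boot all_order all_algebra.
From mathcomp Require Import sesquilinear.
From mathcomp Require Import boolp classical_sets functions cardinality fsbigop.

Local Open Scope classical_set_scope.
Local Open Scope ring_scope.
Import GRing.Theory.

(** Everything rests on two facts about the graded socle. First, the graded
    Jacobson radical kills it ([jacobson_socle]), because the annihilator of a
    nonzero homogeneous element of a simple graded left ideal is a maximal graded
    left ideal. Second, a homogeneous element of [e_j A e_i] outside of the
    radical satisfies [j = i] and is invertible ([peirce_invertible]), by weak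
    basicness and locality of [e_i A_0 e_i]. So whatever acts nontrivially on the
    socle is invertible ([socle_invertible]).

    Let [N] be a graded Nakayama form with degree map [h]. Nondegeneracy provides,
    for each nonzero homogeneous [x] in [e_i Soc], some [y] with [N (y, x)]
    nonzero; this [y] is invertible. It follows that [e_i Soc] lies in
    [A e_(nu i)] and that multiplication by invertible elements identifies the
    nonzero components of [e_i Soc] with the one of degree [h_i]. On that
    component [N (e_i, -)] is injective: [A] being split, [e_i A_0 e_i] is
    spanned by [e_i] and its radical, which kills the socle
    ([socle_unit_inj]). Hence all nonzero components have dimension one
    ([socle_dim1]). Splitness refers to some weakly basic family and is moved to
    the given one by an isomorphism of local corners ([split_residue]). The
    element representing the residue map of [e_i A_0 e_i] generates a simple
    ideal, so [e_i Soc] has a nonzero component of degree [h_i]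
    ([exists_socle]).

    From a graded Nakayama form [F] one gets the bases by completing the socle
    element [w_i] with [F (e_i, w_i) = 1] by a basis of the kernel of
    [F (e_i, -)], since [F (a, b) = F (e_i, a b)]. Conversely, let [F] be given
    by coefficients. Its associativity is immediate on homogeneous elements. For
    nondegeneracy, represent the functional [F (e_i, -)] by the reference form as
    [N (p, -)] with [p] homogeneous. As [N (p, w_i) = 1], the product [p w_i] is
    nonzero, so [p] is invertible, and [F (x, y) = N (p x, y)] for [x] in [e_i A]
    and [y] in [A e_(nu i)]: the form [F] is [N] twisted by a graded bijection,
    hence nondegenerate ([coefficient_nondegenerate]). No comparison of
    dimensions enters, and the degree map of [F] may differ from that of [N]. *)

(** * Components of an internal direct sum *)

Section Components.
Set Implicit Arguments.
Unset Strict Implicit.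
Context {K : fieldType} {V : lmodType K} {I : choiceType} {F : I -> set V}.
Context (F_sub : forall i, subspace (F i)) (F_dec : direct_sum_decomposition F).

Lemma fsum_seq (v : I -> V) (s : seq I) : uniq s ->
  (forall i, i \notin s -> v i = 0) ->
  \sum_(i \in [set: I]) v i = \sum_(i <- s) v i.
Proof.
move=> us s0; rewrite (fsbigE s) // => [|i _ /s0 //].
by apply: eq_bigl => i; rewrite in_setT.
Qed.

Definition component (x : V) : I -> V := sval (cid (F_dec x)).

Lemma component_in i x : F i (component x i).
Proof. by rewrite /component; case: cid => v [[]]. Qed.

Lemma component_seq x : exists2 s : seq I, uniq s &
  (forall i, i \notin s -> component x i = 0) /\
  x = \sum_(i <- s) component x i.
Proof.
rewrite /component; case: cid => v [[_ fin xE] _] /=.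
have [s us] : exists2 s : seq I, uniq s & forall i, i \notin s -> v i = 0.
  case/finite_seqP: fin => s sE; exists (undup s); first exact: undup_uniq.
  move=> i; rewrite mem_undup => nis; apply: contrapT => /= vi.
  by have : [set i | v i <> 0] i by []; rewrite sE /= (negPf nis).
move=> s0; exists s => //; split => //.
by rewrite -fsum_seq.
Qed.

Lemma componentP x (s : seq I) v : uniq s -> (forall i, F i (v i)) ->
  (forall i, i \notin s -> v i = 0) -> x = \sum_(i <- s) v i ->
  component x = v.
Proof.
move=> us Fv s0 xE; rewrite /component; case: cid => u [_ uq] /=; apply: uq.
split => //; last by rewrite xE (fsum_seq us s0).
apply: sub_finite_set (finite_seq s) => i /= vi.
by apply: contrapT => /negP /s0.
Qed.

Lemma component_eq0 i j x : F i x -> i <> j -> component x j = 0.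
Proof.
move=> Fx /eqP ij.
rewrite (@componentP x [:: i] (fun k => if k == i then x else 0)) //.
- by rewrite eq_sym (negPf ij).
- by move=> k; case: eqP => [->//|_]; case: (F_sub k).
- by move=> k; rewrite inE => /negPf ->.
- by rewrite big_seq1 eqxx.
Qed.

Lemma component_id i x : F i x -> component x i = x.
Proof.
move=> Fx.
rewrite (@componentP x [:: i] (fun k => if k == i then x else 0)) ?eqxx //.
- by move=> k; case: eqP => [->//|_]; case: (F_sub k).
- by move=> k; rewrite inE => /negPf ->.
- by rewrite big_seq1 eqxx.
Qed.

Lemma component_linear c x y i :
  component (c *: x + y) i = c *: component x i + component y i.
Proof.
have [s us [s0 xE]] := component_seq x.
have [t ut [t0 yE]] := component_seq y.
have sumE u (r : seq I) v : uniq r -> (forall i, i \notin r -> v i = 0) ->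
    {subset r <= u} -> uniq u -> \sum_(i <- r) v i = \sum_(i <- u) v i :> V.
  move=> ur r0 ru uu; rewrite -(fsum_seq ur r0) (fsum_seq uu) // => j.
  move=> ju; apply: r0; apply: contra ju; exact: ru.
pose u := undup (s ++ t).
have uu : uniq u by exact: undup_uniq.
rewrite (@componentP _ u (fun i => c *: component x i + component y i)) //.
- by move=> k; have [_] := F_sub k; apply; exact: component_in.
- move=> k; rewrite mem_undup mem_cat negb_or => /andP[/s0 -> /t0 ->].
  by rewrite scaler0 addr0.
- rewrite big_split -scaler_sumr /= -(sumE u s) -?(sumE u t) -?xE -?yE //.
  + by move=> k kt; rewrite mem_undup mem_cat kt orbT.
  + by move=> k ks; rewrite mem_undup mem_cat ks.
Qed.

Lemma component_neq0 x : x <> 0 -> exists i, component x i <> 0.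
Proof.
move=> x0; apply: contrapT => /forallNP h; apply: x0.
have [s _ [_ ->]] := component_seq x.
by rewrite big1 // => i _; apply: contrapT => /h.
Qed.

End Components.

(** * Subspaces and functionals on them *)

Section Subspaces.
Set Implicit Arguments.
Unset Strict Implicit.
Context {K : fieldType} {V : lmodType K} {U : set V} (subU : subspace U).

Lemma subspace0 : U 0.
Proof. by case: subU. Qed.

Lemma subspaceD x y : U x -> U y -> U (x + y).
Proof. by case: subU => _ h Ux Uy; rewrite -[x]scale1r; apply: h. Qed.

Lemma subspaceZ c x : U x -> U (c *: x).
Proof. by case: subU => U0 h Ux; rewrite -[_ *: _]addr0; apply: h. Qed.

Lemma subspaceB x y : U x -> U y -> U (x - y).
Proof. by move=> Ux Uy; rewrite -scaleN1r; apply/subspaceD/subspaceZ. Qed.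

Lemma subspace_sum (J : eqType) (s : seq J) (F : J -> V) :
  (forall j, j \in s -> U (F j)) -> U (\sum_(j <- s) F j).
Proof.
move=> UF; rewrite big_seq; elim/big_ind: _ => //.
- exact: subspace0.
- exact: subspaceD.
Qed.

Context {f : V -> K}.
Context (f_lin : forall c x y, U x -> U y -> f (c *: x + y) = c * f x + f y).

Lemma functionalD x y : U x -> U y -> f (x + y) = f x + f y.
Proof. by move=> Ux Uy; rewrite -{1}[x]scale1r f_lin // mul1r. Qed.

Lemma functional0 : f 0 = 0.
Proof.
by apply: (addrI (f 0)); rewrite -functionalD ?addr0 //; exact: subspace0.
Qed.

Lemma functional_sum (J : eqType) (s : seq J) (F : J -> V) :
  (forall j, j \in s -> U (F j)) -> f (\sum_(j <- s) F j) = \sum_(j <- s) f (F j).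
Proof.
elim: s => [|j s IH] UF; first by rewrite !big_nil functional0.
have Us k : k \in s -> U (F k) by move=> sk; apply: UF; rewrite inE sk orbT.
rewrite !big_cons functionalD ?IH //; last exact: subspace_sum.
by apply: UF; rewrite inE eqxx.
Qed.

End Subspaces.
Arguments subspaceD {K V U} subU {x y}.
Arguments subspaceB {K V U} subU {x y}.
Arguments subspaceZ {K V U} subU c {x}.

(** * Arithmetic in a graded algebra *)

Section GradedAlgebra.
Set Implicit Arguments.
Unset Strict Implicit.
Context {K : fieldType} {H : zmodType} {A : graded_algebra K H}.
Implicit Types (x y z : A) (h k : H) (U L M : set A).

Local Notation "x ** y" := (gr_mul A x y) (at level 40, left associativity).

Lemma gr_mul0l x : 0 ** x = 0. Proof. exact: linear0l. Qed.
Lemma gr_mul0r x : x ** 0 = 0. Proof. exact: linear0r. Qed.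
Lemma gr_mulDl x y z : (x + y) ** z = x ** z + y ** z.
Proof. exact: linearDl. Qed.
Lemma gr_mulDr x y z : z ** (x + y) = z ** x + z ** y.
Proof. exact: linearDr. Qed.
Lemma gr_mulBl x y z : (x - y) ** z = x ** z - y ** z.
Proof. exact: linearBl. Qed.
Lemma gr_mulBr x y z : z ** (x - y) = z ** x - z ** y.
Proof. exact: linearBr. Qed.
Lemma gr_mulZl c x z : (c *: x) ** z = c *: (x ** z).
Proof. exact: linearZl_LR. Qed.
Lemma gr_mulZr c x z : z ** (c *: x) = c *: (z ** x).
Proof. exact: linearZr_LR. Qed.
Lemma gr_mul_suml (J : Type) (s : seq J) (F : J -> A) x :
  (\sum_(j <- s) F j) ** x = \sum_(j <- s) F j ** x.
Proof. exact: linear_sumlz. Qed.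
Lemma gr_mul_sumr (J : Type) (s : seq J) (F : J -> A) x :
  x ** (\sum_(j <- s) F j) = \sum_(j <- s) x ** F j.
Proof. exact: linear_sumr. Qed.

Lemma gr_mul_comp h k l x y : gr_comp A h x -> gr_comp A k y -> l = h + k ->
  gr_comp A l (x ** y).
Proof. by move=> hx ky ->; apply: gr_comp_mul. Qed.

(** * Homogeneous components *)

Definition homog x h : A := component (@gr_comp_direct _ _ A) x h.

Lemma homog_in x h : gr_comp A h (homog x h).
Proof. exact: component_in. Qed.

Lemma homog_id x h : gr_comp A h x -> homog x h = x.
Proof. by apply: component_id; exact: gr_comp_subspace. Qed.

Lemma homog_eq0 x h k : gr_comp A h x -> h <> k -> homog x k = 0.
Proof. by apply: component_eq0; exact: gr_comp_subspace. Qed.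

Lemma homog_linear c x y h : homog (c *: x + y) h = c *: homog x h + homog y h.
Proof. by apply: component_linear; exact: gr_comp_subspace. Qed.

Lemma homogB x y h : homog (x - y) h = homog x h - homog y h.
Proof. by rewrite addrC -scaleN1r homog_linear scaleN1r addrC. Qed.

Lemma homog0 h : homog 0 h = 0.
Proof. by have := homogB 0 0 h; rewrite !subrr. Qed.

Lemma homogD x y h : homog (x + y) h = homog x h + homog y h.
Proof. by rewrite -{1}[x]scale1r homog_linear scale1r. Qed.

Lemma homog_neq0 x : x <> 0 -> exists h, homog x h <> 0.
Proof. exact: component_neq0. Qed.

Lemma homog_seq x : exists2 s : seq H, uniq s &
  (forall h, h \notin s -> homog x h = 0) /\ x = \sum_(h <- s) homog x h.
Proof. exact: component_seq. Qed.

Lemma homog_mulr k x y : gr_comp A k y ->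
  forall h, homog (x ** y) h = homog x (h - k) ** y.
Proof.
move=> ky h; have [s us [s0 xE]] := homog_seq x.
rewrite /homog (@componentP _ _ _ _ _ _ [seq l + k | l <- s]
  (fun h => homog x (h - k) ** y)) //.
- by rewrite map_inj_uniq //; exact: addIr.
- by move=> l; apply: gr_mul_comp (homog_in _ _) ky _; rewrite subrK.
- move=> l ls; rewrite s0 ?gr_mul0l //; apply: contra ls => ls.
  by apply/mapP; exists (l - k); rewrite ?subrK.
- rewrite big_map {1}xE gr_mul_suml; apply: eq_bigr => l _.
  by rewrite addrK.
Qed.

Lemma homog_mull k x y : gr_comp A k y ->
  forall h, homog (y ** x) h = y ** homog x (h - k).
Proof.
move=> ky h; have [s us [s0 xE]] := homog_seq x.
rewrite /homog (@componentP _ _ _ _ _ _ [seq l + k | l <- s]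
  (fun h => y ** homog x (h - k))) //.
- by rewrite map_inj_uniq //; exact: addIr.
- by move=> l; apply: gr_mul_comp ky (homog_in _ _) _; rewrite addrC subrK.
- move=> l ls; rewrite s0 ?gr_mul0r //; apply: contra ls => ls.
  by apply/mapP; exists (l - k); rewrite ?subrK.
- rewrite big_map {1}xE gr_mul_sumr; apply: eq_bigr => l _.
  by rewrite addrK.
Qed.

Lemma graded_subspaceP U :
  graded_subspace U <-> subspace U /\ forall x h, U x -> U (homog x h).
Proof.
split=> -[subU gU]; split=> //.
  move=> x h /gU[v [Uv fin xE]]; rewrite /homog /component.
  case: cid => u [_ uq] /=; rewrite (uq v); first by case: (Uv h).
  by split => // k; case: (Uv k).
move=> x Ux; have := @gr_comp_direct _ _ A x; case=> v [[hv fin xE] uq].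
have vE : homog x = v.
  rewrite /homog /component; case: cid => u [[hu finu uE] uqu] /=.
  exact/esym/uq.
by exists v; split => // h; split => //; rewrite -vE; apply: gU.
Qed.

(** * Peirce components *)

(** In terms of the equations [f x = x] and [x g = x], the set [f A_h g] is
    manifestly a subspace, and membership in it is preserved by products. *)
Definition peirce f h g : set A :=
  [set x | [/\ f ** x = x, x ** g = x & gr_comp A h x]].

Definition bipeirce f g : set A := [set x | f ** x = x /\ x ** g = x].

Lemma bipeirce_homog f g h x : gr_comp A 0 f -> gr_comp A 0 g ->
  bipeirce f g x -> peirce f h g (homog x h).
Proof.
move=> f0 g0 [fx xg]; split; last exact: homog_in.
  by rewrite -{2}fx (homog_mull _ f0) subr0.
by rewrite -{2}xg (homog_mulr _ g0) subr0.
Qed.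

Lemma peirce_bipeirce f h g x : peirce f h g x -> bipeirce f g x.
Proof. by case. Qed.

Lemma bipeirce_subspace f g : subspace (bipeirce f g).
Proof.
split; first by split; rewrite ?gr_mul0l ?gr_mul0r.
move=> c x y [fx xg] [fy yg].
by split; rewrite ?gr_mulDl ?gr_mulDr ?gr_mulZl ?gr_mulZr ?fx ?xg ?fy ?yg.
Qed.

Lemma peirce_subspace f h g : subspace (peirce f h g).
Proof.
have [A0 AL] := @gr_comp_subspace _ _ A h; have [B0 BL] := bipeirce_subspace f g.
split; first by case: B0.
move=> c x y [fx xg hx] [fy yg hy].
by have [] := BL c x y (conj fx xg) (conj fy yg); split => //; apply: AL.
Qed.

Lemma peirce_mul f h g k f' l x y : peirce f h g x -> peirce g k f' y ->
  l = h + k -> peirce f l f' (x ** y).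
Proof.
move=> [fx xg hx] [gy yf ky] lE; split; last exact: (gr_mul_comp hx ky lE).
  by rewrite gr_mulA fx.
by rewrite -gr_mulA yf.
Qed.

Lemma bipeirce_mul f g f' x y : bipeirce f g x -> bipeirce g f' y ->
  bipeirce f f' (x ** y).
Proof. by move=> [fx xg] [gy yf]; split; rewrite ?gr_mulA ?fx -?gr_mulA ?yf. Qed.

Section Idempotents.
Context {f g : A} (ff : f ** f = f) (gg : g ** g = g).
Context (f0 : gr_comp A 0 f) (g0 : gr_comp A 0 g).

Lemma peirce_id : peirce f 0 f f.
Proof. by split. Qed.

Lemma mulset_lE U x : (forall y, U y -> U (f ** y)) ->
  mulset_l f U x <-> f ** x = x /\ U x.
Proof.
move=> Uf; split; last by case=> fx Ux; exists x.
by case=> y Uy <-; rewrite gr_mulA ff; split=> //; apply: Uf.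
Qed.

Lemma mulset_lTE x : mulset_l f [set: A] x <-> f ** x = x.
Proof. by rewrite mulset_lE //; split => [[]|]. Qed.

Lemma mulset_l_compE h x :
  mulset_l f (gr_comp A h) x <-> f ** x = x /\ gr_comp A h x.
Proof.
by apply: mulset_lE => y hy; apply: gr_mul_comp f0 hy _; rewrite add0r.
Qed.

Lemma mulset_rTE x : mulset_r [set: A] g x <-> x ** g = x.
Proof.
split; last by move=> xg; exists x.
by case=> y _ <-; rewrite -gr_mulA gg.
Qed.

Lemma mulset_r_compE h x :
  mulset_r (gr_comp A h) g x <-> x ** g = x /\ gr_comp A h x.
Proof.
split; last by case=> xg hx; exists x.
case=> y hy <-; rewrite -gr_mulA gg; split=> //.
by apply: gr_mul_comp hy g0 _; rewrite addr0.
Qed.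

Lemma corner_compE h : corner f (gr_comp A h) g = peirce f h g.
Proof.
apply/seteqP; split=> [_ [y /mulset_l_compE[fy hy] <-]|x [fx xg hx]].
  split; rewrite ?gr_mulA ?fy -?gr_mulA ?gg //.
  by apply: gr_mul_comp hy g0 _; rewrite addr0.
by exists x => //; apply/mulset_l_compE.
Qed.

Lemma cornerTE : corner f [set: A] g = bipeirce f g.
Proof.
apply/seteqP; split=> [_ [y /mulset_lTE fy <-]|x [fx xg]].
  by split; rewrite ?gr_mulA ?fy -?gr_mulA ?gg.
by exists x => //; apply/mulset_lTE.
Qed.

End Idempotents.

End GradedAlgebra.

(** * Local corner algebras *)

Section MaximalIdeals.
Set Implicit Arguments.
Unset Strict Implicit.
Context {K : fieldType} {H : zmodType} {A : graded_algebra K H}.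
Implicit Types (x y z : A) (S L : set A).

Local Notation "x ** y" := (gr_mul A x y) (at level 40, left associativity).

Lemma left_ideal_neq S L u : S u -> (forall x, S x -> x ** u = x) ->
  left_ideal_of S L -> L <> S <-> ~ L u.
Proof.
move=> Su xu [subL LS Lid]; split; last by move=> nLu LE; apply: nLu; rewrite LE.
move=> LnS Lu; apply: LnS; apply/seteqP; split => // x Sx.
by rewrite -(xu x Sx); apply: Lid.
Qed.

(** Zorn's lemma, for the ideals that contain [L] and miss [u]; the empty set is
    added to them so that the empty chain has an upper bound. *)
Lemma exists_maximal_left_ideal S L u :
  S u -> (forall x, S x -> x ** u = x) -> left_ideal_of S L -> ~ L u ->
  exists2 M, maximal_left_ideal_of S M & L `<=` M.
Proof.
move=> Su xu Lid Lu.
pose P : set (set A) :=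
  [set X | X = set0 \/ [/\ left_ideal_of S X, ~ X u & L `<=` X]].
have [|M [PM Mmax]] := @Zorn_bigcup A P.
  move=> F FP Ftot; have [[X [FX X0]]|noX] := pselect (exists X, F X /\ X <> set0).
    have XP Y : F Y -> Y <> set0 -> [/\ left_ideal_of S Y, ~ Y u & L `<=` Y].
      by move=> /FP[].
    have in2 x y : (\bigcup_(Y in F) Y) x -> (\bigcup_(Y in F) Y) y ->
        exists Y, [/\ F Y, Y <> set0, Y x & Y y].
      move=> [Y FY Yx] [Z FZ Zy]; have [YZ|ZY] := Ftot Y Z FY FZ.
        by exists Z; split => //; [move=> Z0; rewrite Z0 in Zy|apply: YZ].
      by exists Y; split => //; [move=> Y0; rewrite Y0 in Yx|apply: ZY].
    right; split.
    - split.
      + have [[[X00 _] _ _] _ _] := XP X FX X0.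
        split; first by exists X.
        move=> c x y Ux Uy; have [Y [FY Y0 Yx Yy]] := in2 x y Ux Uy.
        by exists Y => //; have [[[_ YL] _ _] _ _] := XP Y FY Y0; apply: YL.
      + move=> x [Y FY Yx]; have Y0 : Y <> set0 by move=> Y0; rewrite Y0 in Yx.
        by have [[_ YS _] _ _] := XP Y FY Y0; apply: YS.
      + move=> s x Ss Ux; have [Y [FY Y0 Yx _]] := in2 x x Ux Ux.
        by exists Y => //; have [[_ _ Ym] _ _] := XP Y FY Y0; apply: Ym.
    - move=> Uu; have [Y [FY Y0 Yu _]] := in2 u u Uu Uu.
      by have [_ nYu _] := XP Y FY Y0.
    - by move=> x Lx; exists X => //; have [_ _ LX] := XP X FX X0; apply: LX.
  left; apply/seteqP; split=> // x [X FX Xx]; apply: noX; exists X; split=> // X0.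
  by rewrite X0 in Xx.
have L0 : L 0 by case: Lid => -[].
have [M0|[Mid Mu LM]] := PM.
  exfalso; apply: (Mmax L); last by right; split.
  by rewrite M0; split => // /(_ 0 L0).
exists M => //; split => //; first by apply/(left_ideal_neq Su xu Mid).
move=> N Nid MN NS; apply: contrapT => NM; apply: (Mmax N).
  by split => // NsM; apply: NM; apply/seteqP; split.
right; split => //; first by apply/(left_ideal_neq Su xu Nid).
by apply: subset_trans MN.
Qed.

Context {u : A} (uu : u ** u = u) (u0 : gr_comp A 0 u).

Local Notation R := (peirce u 0 u).

(** The working form of locality of [u A_0 u]: a dichotomy between the
    maximal left ideal [M] and the left invertible elements. Two-sidedness is
    recovered from the absence of nontrivial idempotents. *)
Definition local_at (M : set A) : Prop :=
  [/\ subspace M, M `<=` R, forall s x, R s -> M x -> M (s ** x), ~ M u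
    & forall x, R x -> ~ M x -> exists2 z, R z & z ** x = u].

Lemma local_atP : local_algebra (corner u (gr_comp A 0) u) ->
  exists M, local_at M.
Proof.
rewrite corner_compE //; case=> M [[Mid MR Mmax] Muq].
have Ru : R u by exact: peirce_id.
have xu x : R x -> x ** u = x by case.
exists M; have [subM MsR Mmul] := Mid; split => //.
  by apply/(left_ideal_neq Ru xu Mid).
move=> x Rx nMx; pose L := [set y | exists2 z, R z & y = z ** x].
apply: contrapT => nL.
have [||N Nmax LN] := @exists_maximal_left_ideal R L u Ru xu.
- have [R0 RL] := peirce_subspace u 0 u; split.
  + split; first by exists 0; rewrite ?gr_mul0l.
    move=> c _ _ [y Ry ->] [z Rz ->]; exists (c *: y + z); first exact: RL.
    by rewrite gr_mulDl gr_mulZl.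
  + by move=> _ [y Ry ->]; apply: peirce_mul Ry Rx _; rewrite add0r.
  + move=> s _ Rs [z Rz ->]; exists (s ** z); last by rewrite gr_mulA.
    by apply: peirce_mul Rs Rz _; rewrite add0r.
- by case=> z Rz uE; apply: nL; exists z.
apply: nMx; rewrite (Muq N) //; apply: LN; exists u => //.
by case: Rx => ->.
Qed.

(** Of an idempotent and its complement, one lies outside of [M] and is therefore
    left invertible; an idempotent with a left inverse is the unit. *)
Lemma local_at_idempotent M x : local_at M -> R x -> x ** x = x ->
  x = 0 \/ x = u.
Proof.
move=> [subM MR Mmul Mu Minv] Rx xx; have [ux xu _] := Rx.
have Ru : R u by exact: peirce_id.
have [Mx|nMx] := pselect (M x); [left|right].
  have [||z _ zE] := Minv (u - x).
  - exact: (subspaceB (peirce_subspace u 0 u) Ru Rx).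
  - by move=> Mux; apply: Mu; rewrite -(subrK x u); apply: subspaceD.
  by rewrite -ux -zE -gr_mulA gr_mulBl ux xx subrr gr_mul0r.
have [z _ zx] := Minv x Rx nMx.
by rewrite -zx -{2}xx gr_mulA zx ux.
Qed.

End MaximalIdeals.
Arguments local_at {K H A} u M.

(** * The graded socle *)

Section GradedIdeals.
Set Implicit Arguments.
Unset Strict Implicit.
Context {K : fieldType} {H : zmodType} {A : graded_algebra K H}.
Implicit Types (x y z : A) (S L : set A).

Local Notation "x ** y" := (gr_mul A x y) (at level 40, left associativity).

Lemma graded_left_idealP L : graded_left_ideal L <->
  [/\ subspace L, forall a x, L x -> L (a ** x)
    & forall x h, L x -> L (homog x h)].
Proof.
split.
  by case=> [[subL _ Lm]] /graded_subspaceP[_ Lh]; split => // a x; apply: Lm.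
case=> subL Lm Lh; split; last exact/graded_subspaceP.
by split => // a x _; apply: Lm.
Qed.

Lemma graded_left_idealT : graded_left_ideal [set: A].
Proof. by apply/graded_left_idealP; split. Qed.

Lemma graded_left_ideal_mulr L d u : graded_left_ideal L -> gr_comp A d u ->
  graded_left_ideal [set a ** u | a in L].
Proof.
move=> /graded_left_idealP[[L0 LL] Lm Lh] du; apply/graded_left_idealP; split.
- split; first by exists 0; rewrite ?gr_mul0l.
  move=> c _ _ [x Lx <-] [y Ly <-]; exists (c *: x + y); first exact: LL.
  by rewrite gr_mulDl gr_mulZl.
- by move=> a _ [x Lx <-]; exists (a ** x); rewrite ?gr_mulA //; exact: Lm.
- move=> _ h [x Lx <-]; exists (homog x (h - d)); first exact: Lh.
  by rewrite (homog_mulr _ du).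
Qed.

Lemma graded_left_ideal_add L L' : graded_left_ideal L -> graded_left_ideal L' ->
  graded_left_ideal [set x + y | x in L & y in L'].
Proof.
move=> /graded_left_idealP[[L0 LL] Lm Lh] /graded_left_idealP[[L'0 LL'] Lm' Lh'].
apply/graded_left_idealP; split.
- split; first by exists 0 => //; exists 0; rewrite ?addr0.
  move=> c _ _ [x Lx [y Ly <-]] [x' Lx' [y' Ly' <-]].
  exists (c *: x + x'); first exact: LL.
  exists (c *: y + y'); first exact: LL'.
  by rewrite scalerDr addrACA.
- move=> a _ [x Lx [y Ly <-]]; exists (a ** x); first exact: Lm.
  by exists (a ** y); [exact: Lm'|rewrite gr_mulDr].
- move=> _ h [x Lx [y Ly <-]]; exists (homog x h); first exact: Lh.
  by exists (homog y h); [exact: Lh'|rewrite homogD].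
Qed.

Lemma socle_simple L x : simple_graded_left_ideal L -> L x -> graded_socle A x.
Proof.
move=> sL Lx; exists [:: x]; last by rewrite big_seq1.
by move=> y; rewrite inE => /eqP ->; exists L.
Qed.

Lemma socle_mul a x : graded_socle A x -> graded_socle A (a ** x).
Proof.
case=> s sP ->; exists [seq a ** y | y <- s]; last first.
  by rewrite big_map gr_mul_sumr.
move=> _ /mapP[y /sP[L sL Ly] ->]; exists L => //.
by case: sL => /graded_left_idealP[_ Lm _] _ _; apply: Lm.
Qed.

Lemma socle_subspace : subspace (graded_socle A).
Proof.
split; first by exists [::]; rewrite ?big_nil.
move=> c _ _ [s sP ->] [t tP ->]; exists ([seq c *: y | y <- s] ++ t).
  move=> y; rewrite mem_cat => /orP[/mapP[z /sP[L sL Lz] ->]|/tP //].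
  exists L => //; case: sL => /graded_left_idealP[subL _ _] _ _.
  exact: subspaceZ.
by rewrite big_cat big_map scaler_sumr.
Qed.

(** For [l] homogeneous and nonzero in a simple graded left ideal [L], [L] is
    [A l], so that the annihilator of [l] is a maximal graded left ideal. *)
Lemma annihilator_maximal L d l : (forall x, x <> 0 -> exists u, u ** x <> 0) ->
  simple_graded_left_ideal L -> L l -> gr_comp A d l -> l <> 0 ->
  maximal_graded_left_ideal [set a | a ** l = 0].
Proof.
move=> unital [gL _ Lmin] Ll dl l0; split.
- apply/graded_left_idealP; split => /=.
  + split; first by rewrite /= gr_mul0l.
    by move=> c x y /= x0 y0; rewrite gr_mulDl gr_mulZl x0 y0 scaler0 addr0.
  + by move=> a x /= x0; rewrite -gr_mulA x0 gr_mul0r.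
  + move=> x h /= x0; rewrite -{1}(addrK d h) -(homog_mulr _ dl) x0.
    exact: homog0.
- move=> annT; have [u ul] := unital l l0; apply: ul.
  by have : [set: A] u by []; rewrite -annT.
- move=> L' gL' annL' L'T; apply/seteqP; split => // a L'a; apply: contrapT => al.
  apply: L'T; apply/seteqP; split => // b _.
  have /graded_left_idealP[[L'0 LL'] L'm _] := gL'.
  (* [L' l] is a nonzero graded left ideal inside [L], hence contains [l]; if
     [l = a' l] then every [b - b a'] annihilates [l]. *)
  have : [set a ** l | a in L'] = L.
    apply: Lmin; first exact: graded_left_ideal_mulr gL' dl.
    - have /graded_left_idealP[_ Lm _] := gL.
      by move=> _ [x _ <-]; apply: Lm.
    - by move=> E; apply: al; have : [set a ** l | a in L'] (a ** l) by [exists a];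
        rewrite E.
  move=> E; have [a' L'a' a'l] : [set a ** l | a in L'] l by rewrite E.
  rewrite -(subrK (b ** a') b); apply: (subspaceD (conj L'0 LL')); last first.
    exact: L'm.
  by apply: annL' => /=; rewrite gr_mulBl -gr_mulA a'l subrr.
Qed.

(** An element of the radical lies in every maximal graded left ideal, in
    particular in the annihilators of homogeneous elements of simple ideals. *)
Lemma jacobson_socle a x : (forall x, x <> 0 -> exists u, u ** x <> 0) ->
  graded_jacobson_radical A a -> graded_socle A x -> a ** x = 0.
Proof.
move=> unital Ja [s sP ->]; rewrite gr_mul_sumr big_seq big1 // => y /sP[L sL Ly].
have [t _ [_ ->]] := homog_seq y; rewrite gr_mul_sumr big1 // => h _.
have [->|/eqP y0] := eqVneq (homog y h) 0; first exact: gr_mul0r.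
apply: (Ja [set a | a ** homog y h = 0]).
apply: (@annihilator_maximal L h) => //; last exact: homog_in.
by have [/graded_left_idealP[_ _ Lh] _ _] := sL; apply: Lh.
Qed.

End GradedIdeals.

(** * Weakly basic families *)

Section WeaklyBasic.
Set Implicit Arguments.
Unset Strict Implicit.
Context {K : fieldType} {H : zmodType} {A : graded_algebra K H}.
Context {I : choiceType} {e : I -> A} (e_wb : weakly_basic_family e).
Implicit Types (x y z : A) (i j : I).

Local Notation "x ** y" := (gr_mul A x y) (at level 40, left associativity).
Local Notation J := (graded_jacobson_radical A).
Local Notation Soc := (graded_socle A).
Local Notation "A_[ i , h , j ]" := (peirce (e i) h (e j)).

Lemma wb_idem i : e i ** e i = e i.
Proof. by case: e_wb => -[/(_ i)[]]. Qed.

Lemma wb_deg0 i : gr_comp A 0 (e i).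
Proof. by case: e_wb => -[/(_ i)[]]. Qed.

Lemma wb_neq0 i : e i <> 0.
Proof. by case: e_wb => -[/(_ i)[]]. Qed.

Lemma wb_orth i j : i <> j -> e i ** e j = 0.
Proof. by case: e_wb => -[_ h _ _] _ _ _; apply: h. Qed.

Lemma wb_peirce_id i : A_[i, 0, i] (e i).
Proof. by apply: peirce_id; [exact: wb_idem|exact: wb_deg0]. Qed.

Lemma wb_bipeirce_id i : bipeirce (e i) (e i) (e i).
Proof. by split; exact: wb_idem. Qed.

(** Common to the decompositions [A = sum_i e_i A] and [A = sum_i A e_i]: the
    summands are the images of orthogonal projections, so that the components of
    [x] can only be the [p_i x]. *)
Lemma projections_sum (p : I -> A -> A) :
  (forall i (s : seq I) (F : I -> A),
     p i (\sum_(j <- s) F j) = \sum_(j <- s) p i (F j)) ->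
  (forall i x, p i (p i x) = p i x) ->
  (forall i j x, i <> j -> p i (p j x) = 0) ->
  direct_sum_decomposition (fun i => [set p i x | x in [set: A]]) ->
  forall x, exists s : seq I, x = \sum_(i <- s) p i x.
Proof.
move=> p_sum pp p_orth dec x.
have [s us [_ xE]] := component_seq dec x; exists s.
rewrite {1}xE [LHS]big_seq [RHS]big_seq; apply: eq_bigr => i si.
have pc j : exists y, p j y = component dec x j.
  by have [y _ yE] := component_in dec j x; exists y.
rewrite [in RHS]xE p_sum (bigD1_seq i) //= big1 ?addr0 => [|j ji].
  by have [y <-] := pc i; rewrite pp.
by have [y <-] := pc j; rewrite p_orth // => ij; rewrite ij eqxx in ji.
Qed.

Lemma wb_left_sum x : exists s : seq I, x = \sum_(i <- s) e i ** x.
Proof.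
apply: (@projections_sum (fun i x => e i ** x)).
- by move=> i s F; rewrite gr_mul_sumr.
- by move=> i y; rewrite gr_mulA wb_idem.
- by move=> i j y ij; rewrite gr_mulA wb_orth ?gr_mul0l.
- by case: e_wb => -[].
Qed.

Lemma wb_right_sum x : exists s : seq I, x = \sum_(i <- s) x ** e i.
Proof.
apply: (@projections_sum (fun i x => x ** e i)).
- by move=> i s F; rewrite gr_mul_suml.
- by move=> i y; rewrite -gr_mulA wb_idem.
- move=> i j y ij; rewrite -gr_mulA wb_orth ?gr_mul0r //.
  by move=> ji; apply: ij.
- by case: e_wb => -[].
Qed.

Lemma wb_left_neq0 x : x <> 0 -> exists i, e i ** x <> 0.
Proof.
move=> x0; apply: contrapT => /forallNP h; apply: x0.
have [s ->] := wb_left_sum x.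
by rewrite big1 // => i _; apply: contrapT => /h.
Qed.

Lemma wb_right_neq0 x : x <> 0 -> exists i, x ** e i <> 0.
Proof.
move=> x0; apply: contrapT => /forallNP h; apply: x0.
have [s ->] := wb_right_sum x.
by rewrite big1 // => i _; apply: contrapT => /h.
Qed.

Lemma wb_unital x : x <> 0 -> exists u, u ** x <> 0.
Proof. by move=> /wb_left_neq0[i]; exists (e i). Qed.

Lemma wb_local i : exists M, local_at (e i) M.
Proof.
apply: local_atP; [exact: wb_idem|exact: wb_deg0|].
by case: e_wb.
Qed.

Definition local_radical i : set A := sval (cid (wb_local i)).

Lemma local_radicalP i : local_at (e i) (local_radical i).
Proof. exact: svalP (cid (wb_local i)). Qed.

Lemma peirce_idempotent i x : A_[i, 0, i] x -> x ** x = x -> x = 0 \/ x = e i.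
Proof.
exact: (local_at_idempotent (wb_idem i) (wb_deg0 i) (local_radicalP i)).
Qed.

(** [y z] is an idempotent of the local algebra [e_i A_0 e_i]. It is nonzero,
    since [z (y z) y = e_i]. *)
Lemma peirce_left_inverse i k y z : A_[i, k, i] y -> A_[i, - k, i] z ->
  z ** y = e i -> y ** z = e i.
Proof.
move=> iy iz zy; have [ey ye _] := iy.
have [||yz0|//] := @peirce_idempotent i (y ** z).
- by apply: peirce_mul iy iz _; rewrite subrr.
- by rewrite gr_mulA -[y ** z ** y]gr_mulA zy ye.
exfalso; apply: (@wb_neq0 i).
by rewrite -zy -[y]ye -zy [y ** _]gr_mulA yz0 gr_mul0l gr_mul0r.
Qed.

(** If a maximal graded left ideal [M] misses [y], then [A = M + A y], and in
    the degree [0] part of [e_i = m + a y] the local algebra [e_i A_0 e_i]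
    leaves no other choice than [e_i a y] invertible. *)
Lemma peirce_invertible j k i y : A_[j, k, i] y -> ~ J y ->
  j = i /\ exists z, [/\ A_[i, - k, i] z, z ** y = e i & y ** z = e i].
Proof.
move=> jyi nJy; have [ey ye ky] := jyi.
have ji : j = i.
  apply: contrapT => ji; apply: nJy; case: e_wb => _ _ _ /(_ j i ji); apply.
  rewrite cornerTE //; exact: wb_idem.
split => //; subst j.
suff [z iz zy] : exists2 z, A_[i, - k, i] z & z ** y = e i.
  by exists z; split => //; exact: (peirce_left_inverse jyi iz zy).
have [M [gM MT Mmax] nMy] : exists2 M, maximal_graded_left_ideal M & ~ M y.
  apply: contrapT => h; apply: nJy => M maxM; apply: contrapT => nMy.
  by apply: h; exists M.
have /graded_left_idealP[subM Mm Mh] := gM.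
have [m Mm0 [_ [a _ <-] eE]] :
    [set m + b | m in M & b in [set a ** y | a in [set: A]]] (e i).
  apply: contrapT => ne; apply: nMy.
  rewrite -(Mmax [set m + b | m in M & b in [set a ** y | a in [set: A]]]).
  - exists 0; first exact: subspace0.
    by exists y; rewrite ?add0r //; exists (e i).
  - apply: graded_left_ideal_add => //.
    exact: graded_left_ideal_mulr graded_left_idealT ky.
  - move=> m Mm0; exists m => //; exists 0; rewrite ?addr0 //.
    by exists 0; rewrite ?gr_mul0l.
  - by move=> T; apply: ne; rewrite T.
(* The part of [e_i = m + a y] that lies in [e_i A_0 e_i]. *)
pose m0 := e i ** homog m 0; pose b := e i ** homog a (- k) ** y.
have eE0 : e i = m0 + b.
  have := congr1 (fun x => e i ** homog x 0) eE.
  by rewrite homogD (homog_mulr _ ky) sub0r gr_mulDr gr_mulA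
    (homog_id (wb_deg0 i)) wb_idem.
have [_ _ _ rad1 rad_inv] := local_radicalP i.
have [subrad _ rad_mul _ _] := local_radicalP i.
have ib : A_[i, 0, i] b.
  split; rewrite /b ?gr_mulA ?wb_idem // -?gr_mulA ?ye //.
  apply: (gr_mul_comp (wb_deg0 i) _ (esym (add0r _))).
  by apply: gr_mul_comp (homog_in _ _) ky _; rewrite addNr.
have im : A_[i, 0, i] m0.
  have -> : m0 = e i - b by rewrite eE0 addrK.
  exact: (subspaceB (peirce_subspace _ _ _) (wb_peirce_id i) ib).
have radm : local_radical i m0.
  apply: contrapT => /(rad_inv _ im)[z iz zm]; apply: nMy.
  rewrite -ye; apply: (Mm); rewrite -zm; apply: (Mm); apply: (Mm).
  exact: Mh.
have [|z iz zb] := rad_inv b ib.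
  by move=> radb; apply: rad1; rewrite eE0; apply: subspaceD.
exists (z ** homog a (- k) ** e i).
  have [ez ze z0] := iz; split; rewrite -?gr_mulA ?wb_idem ?gr_mulA ?ez //.
  apply: (gr_mul_comp _ (wb_deg0 i) (esym (addr0 _))).
  by apply: gr_mul_comp z0 (homog_in _ _) _; rewrite add0r.
have [_ ze _] := iz.
by rewrite -[RHS]zb /b -[_ ** e i ** y]gr_mulA ey !gr_mulA ze.
Qed.

(** The radical kills the socle, so an element that acts nontrivially on the socle
    is not in the radical. This is how invertible elements are found below. *)
Lemma socle_invertible j k i y x : A_[j, k, i] y -> Soc x -> y ** x <> 0 ->
  j = i /\ exists z, [/\ A_[i, - k, i] z, z ** y = e i & y ** z = e i].
Proof.
move=> jy Sx yx; apply: peirce_invertible jy _ => Jy; apply: yx.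
exact: jacobson_socle wb_unital Jy Sx.
Qed.

Lemma local_radical_socle i y x : local_radical i y -> Soc x -> y ** x = 0.
Proof.
move=> rady Sx; apply: contrapT => yx.
have [_ radR rad_mul rad1 _] := local_radicalP i.
have [_ [z [iz zy _]]] := socle_invertible (radR _ rady) Sx yx.
by apply: rad1; rewrite -zy; apply: rad_mul => //; rewrite -[0]oppr0.
Qed.

(** A homogeneous [u] which can be recovered from each of its nonzero multiples
    generates a simple graded left ideal. *)
Lemma recoverable_socle i d u : e i ** u = u -> gr_comp A d u ->
  (forall j k y, A_[j, k, i] y -> y ** u <> 0 ->
     exists z, z ** (y ** u) = u) -> Soc u.
Proof.
move=> eu du rec; have [->|/eqP u0] := eqVneq u 0.
  exact: subspace0 socle_subspace.
pose L : set A := [set a ** u | a in [set: A]].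
have Lu : L u by exists (e i).
have gL : graded_left_ideal L.
  exact: graded_left_ideal_mulr graded_left_idealT du.
apply: (@socle_simple _ _ _ L) => //; split=> //.
  by move=> L0; apply: u0; move: Lu; rewrite L0.
move=> L' gL' L'L L'0; apply/seteqP; split=> // _ [a _ <-].
have /graded_left_idealP[sub' L'm L'h] := gL'.
apply: (L'm); have [x L'x x0] : exists2 x, L' x & x <> 0.
  apply: contrapT => h; apply: L'0; apply/seteqP; split=> x /=.
    by move=> L'x; apply: contrapT => x0; apply: h; exists x.
  by move=> ->; apply: subspace0.
have [h xh] := homog_neq0 x0; have [j xj] := wb_left_neq0 xh.
have [b _ bE] := L'L x L'x.
have [||z zE] := rec j (h - d) (e j ** homog b (h - d) ** e i).
- split; rewrite ?gr_mulA ?wb_idem // -?gr_mulA ?wb_idem //.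
  apply: (gr_mul_comp (wb_deg0 j) _ (esym (add0r _))).
  exact: (gr_mul_comp (homog_in _ _) (wb_deg0 i) (esym (addr0 _))).
- by rewrite -gr_mulA eu -gr_mulA -(homog_mulr _ du) bE.
rewrite -zE -[_ ** e i ** u]gr_mulA eu -gr_mulA -(homog_mulr _ du) bE.
by apply: (L'm); apply: (L'm); apply: L'h.
Qed.

End WeaklyBasic.

(** * Residue fields *)

Section Residue.
Set Implicit Arguments.
Unset Strict Implicit.
Context {K : fieldType} {H : zmodType} {A : graded_algebra K H}.
Context (A_split : split_algebra A).
Context {I : choiceType} {e : I -> A} (e_wb : weakly_basic_family e).
Implicit Types (x y z : A) (i j : I).

Local Notation "x ** y" := (gr_mul A x y) (at level 40, left associativity).
Local Notation "A_[ i , h , j ]" := (peirce (e i) h (e j)).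

(** Splitness is known for the local algebras [f_j A_0 f_j] of some weakly basic
    family [f], and has to be transferred to [e]. As [e_i] is a finite sum of
    terms [e_i f_j e_i] and [e_i A_0 e_i] is local, one of these terms is
    invertible, which gives [p] and [q] of degree [0] with [p q = e_i]. Then
    [q p] is a nonzero idempotent of [f_j A_0 f_j], hence [q p = f_j], and
    [y |-> q y p] is an isomorphism [e_i A_0 e_i -> f_j A_0 f_j]. *)
Lemma split_residue i y : A_[i, 0, i] y ->
  exists c, local_radical e_wb i (y - c *: e i).
Proof.
move=> iy; have [J [f [f_wb f_split]]] := A_split.
have [subrad radR _ rad1 rad_inv] := local_radicalP e_wb i.
have e0 := wb_deg0 e_wb i; have ee := wb_idem e_wb i.
have [j nrad] : exists j : J, ~ local_radical e_wb i (e i ** f j ** e i).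
  apply: contrapT => /forallNP h; apply: rad1.
  have [s eE] := wb_left_sum f_wb (e i).
  have -> : e i = \sum_(j <- s) e i ** f j ** e i.
    rewrite -[LHS]ee [in LHS]eE gr_mul_sumr -eE.
    by apply: eq_bigr => j _; rewrite gr_mulA.
  by apply: subspace_sum => // j _; apply: contrapT => /h.
have f0 := wb_deg0 f_wb j; have ff := wb_idem f_wb j.
have [|g ig gE] := rad_inv (e i ** f j ** e i) _ nrad.
  split; rewrite ?gr_mulA ?ee // -?gr_mulA ?ee //.
  apply: (gr_mul_comp e0 _ (esym (addr0 0))).
  exact: (gr_mul_comp f0 e0 (esym (addr0 0))).
have [eg ge g0] := ig.
pose p := g ** f j; pose q := f j ** e i.
have ip : peirce (e i) 0 (f j) p.
  split; rewrite /p ?gr_mulA ?eg // -?gr_mulA ?ff //.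
  exact: (gr_mul_comp g0 f0 (esym (addr0 0))).
have jq : peirce (f j) 0 (e i) q.
  split; rewrite /q ?gr_mulA ?ff // -?gr_mulA ?ee //.
  exact: (gr_mul_comp f0 e0 (esym (addr0 0))).
have pq : p ** q = e i.
  rewrite -[RHS]gE /p /q !gr_mulA ge -[g ** _ ** f j]gr_mulA.
  by rewrite ff.
clearbody p q.
have jxj x : A_[i, 0, i] x -> peirce (f j) 0 (f j) (q ** x ** p).
  move=> ix; apply: (peirce_mul _ ip (esym (addr0 0))).
  exact: (peirce_mul jq ix (esym (addr0 0))).
have [_ qe _] := jq; have [ep _ _] := ip.
have qp : q ** p = f j.
  have [||qp0|//] := @peirce_idempotent _ _ _ _ _ f_wb j (q ** p).
  - exact: (peirce_mul jq ip (esym (addr0 0))).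
  - by rewrite gr_mulA -[q ** p ** q]gr_mulA pq qe.
  exfalso; apply: (wb_neq0 e_wb (i := i)).
  by rewrite -pq -[p]ep -pq -[p ** q ** p]gr_mulA qp0 gr_mul0r gr_mul0l.
have [phi []] := f_split j; rewrite corner_compE // => _ _ phi_lin phi_mul phi1.
have Rf := wb_peirce_id f_wb j.
exists (phi (q ** y ** p)); set c := phi _; apply: contrapT => nrady.
have [|g' ig' g'E] := rad_inv _ _ nrady.
  have subR := peirce_subspace (e i) 0 (e i).
  exact: (subspaceB subR iy (subspaceZ subR c (wb_peirce_id e_wb i))).
have phi0 : phi (q ** (y - c *: e i) ** p) = 0.
  have -> : q ** (y - c *: e i) ** p = - c *: f j + q ** y ** p.
    by rewrite gr_mulBr gr_mulBl gr_mulZr qe gr_mulZl qp scaleNr addrC.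
  by rewrite phi_lin ?phi1 ?mulr1 ?addNr //; exact: jxj.
have /eqP := phi1; rewrite -qp -{1}qe -g'E.
have [_ g'e _] := ig'.
have -> : q ** (g' ** (y - c *: e i)) ** p
    = (q ** g' ** p) ** (q ** (y - c *: e i) ** p).
  by rewrite !gr_mulA -[_ ** p ** q]gr_mulA pq -[q ** g' ** e i]gr_mulA g'e.
rewrite phi_mul ?phi0 ?mulr0 ?(eq_sym 0) ?oner_eq0 //; apply: jxj => //.
have subR := peirce_subspace (e i) 0 (e i).
exact: (subspaceB subR iy (subspaceZ subR c (wb_peirce_id e_wb i))).
Qed.

(** The residue map [e_i A_0 e_i -> K], as a functional that a form can
    represent: [y] is a multiple of [e_i] modulo the radical, by a unique scalar. *)
Lemma residue_functional i : exists rho : A -> K,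
  [/\ forall c x y, A_[i, 0, i] x -> A_[i, 0, i] y ->
        rho (c *: x + y) = c * rho x + rho y,
      rho (e i) = 1
    & forall y, A_[i, 0, i] y -> local_radical e_wb i y -> rho y = 0].
Proof.
have [subrad radR _ rad1 _] := local_radicalP e_wb i.
have [R0 RL] := peirce_subspace (e i) 0 (e i).
have uniq c d y : local_radical e_wb i (y - c *: e i) ->
    local_radical e_wb i (y - d *: e i) -> c = d.
  move=> radc radd; apply: contrapT => /eqP; rewrite -subr_eq0 => cd.
  apply: rad1; rewrite -[e i]scale1r -(mulVf cd) -scalerA.
  apply: subspaceZ => //; rewrite scalerBl.
  have -> : c *: e i - d *: e i = (y - d *: e i) - (y - c *: e i).
    by rewrite opprB [RHS]addrC addrA subrK.
  exact: (subspaceB subrad).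
have [rho rhoP] : exists rho : A -> K, forall y, A_[i, 0, i] y ->
    local_radical e_wb i (y - rho y *: e i).
  have ex y : exists c, A_[i, 0, i] y -> local_radical e_wb i (y - c *: e i).
    have [/split_residue[c]|ny] := pselect (A_[i, 0, i] y); first by exists c.
    by exists 0.
  by exists (fun y => sval (cid (ex y))) => y; exact: svalP (cid (ex y)).
have Ri := wb_peirce_id e_wb i.
exists rho; split => //.
- move=> c x y Rx Ry; apply: (uniq _ _ (c *: x + y)).
    by apply: rhoP; apply: RL.
  have -> : c *: x + y - (c * rho x + rho y) *: e i =
      c *: (x - rho x *: e i) + (y - rho y *: e i).
    by rewrite scalerDl scalerBr scalerA opprD addrACA.
  by case: subrad => _; apply; exact: rhoP.
- apply: (uniq _ _ (e i)); first exact: rhoP.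
  by rewrite scale1r subrr; exact: subspace0.
- move=> y Ry rady; apply: (uniq _ _ y); first exact: rhoP.
  by rewrite scale0r subr0.
Qed.

End Residue.

(** * Graded bilinear forms *)

Section GradedForms.
Set Implicit Arguments.
Unset Strict Implicit.
Context {K : fieldType} {H : zmodType} {A : graded_algebra K H}.
Implicit Types (x y : A) (U W : set A) (G : A -> A -> K).

(** Bilinearity as a property of a bare function, so that a form and its
    transpose can be handled alike. *)
Definition bilinear_form G : Prop :=
  (forall c x x' y, G (c *: x + x') y = c * G x y + G x' y) /\
  (forall c x y y', G x (c *: y + y') = c * G x y + G x y').

Lemma biscalar_bilinear (N : {biscalar A}) : bilinear_form N.
Proof. by split=> c x y z; rewrite ?linearPl ?linearPr. Qed.

Lemma bilinear_form_tr G : bilinear_form G -> bilinear_form (fun y x => G x y).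
Proof. by case=> Gl Gr; split=> *; [exact: Gr|exact: Gl]. Qed.

Lemma subspaceT : subspace [set: A].
Proof. by []. Qed.

Section Bilinear.
Context {G : A -> A -> K} (Gbil : bilinear_form G).

Lemma form_addr x y y' : G x (y + y') = G x y + G x y'.
Proof. by case: Gbil => _ Gr; rewrite -{1}[y]scale1r Gr mul1r. Qed.

Lemma form_addl x x' y : G (x + x') y = G x y + G x' y.
Proof. by case: Gbil => Gl _; rewrite -{1}[x]scale1r Gl mul1r. Qed.

Lemma form_0r x : G x 0 = 0.
Proof. by apply: (addrI (G x 0)); rewrite -form_addr !addr0. Qed.

Lemma form_suml (T : eqType) (s : seq T) F y :
  G (\sum_(t <- s) F t) y = \sum_(t <- s) G (F t) y.
Proof.
have [Gl _] := Gbil.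
exact: (functional_sum subspaceT (f := G^~ y)).
Qed.

Lemma form_sumr (T : eqType) (s : seq T) F x :
  G x (\sum_(t <- s) F t) = \sum_(t <- s) G x (F t).
Proof.
have [_ Gr] := Gbil.
by apply: (functional_sum subspaceT (f := G x)) => // *; exact: Gr.
Qed.

Lemma form_neq0_homogr x y : G x y <> 0 -> exists k, G x (homog y k) <> 0.
Proof.
move=> xy; apply: contrapT => /forallNP h; apply: xy.
have [s _ [_ ->]] := homog_seq y.
by rewrite form_sumr big1 // => k _; apply: contrapT => /h.
Qed.

Lemma form_homogr x y k : (forall m, m <> k -> G x (homog y m) = 0) ->
  G x y = G x (homog y k).
Proof.
move=> h; suff yk : G x (y - homog y k) = 0.
  by rewrite -{1}(subrK (homog y k) y) form_addr yk add0r.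
apply: contrapT => /form_neq0_homogr[m]; rewrite homogB.
have [->|mk] := pselect (m = k).
  rewrite (homog_id (homog_in _ _)) subrr => h0; exact: h0 (form_0r x).
by rewrite (homog_eq0 (homog_in _ _) (nesym mk)) subr0 => /(_ (h _ mk)).
Qed.

(** Only the finitely many degrees [d - k], with [k] a degree of [y], can pair
    nontrivially with [y]. *)
Lemma form_graded_dual U W d : graded_subspace W -> form_of_degree G U W d ->
  forall y, W y -> graded_dual U (G^~ y).
Proof.
move=> /graded_subspaceP[_ Wh] deg y Wy; split.
  by move=> *; case: Gbil => Gl _; exact: Gl.
have [s _ [_ yE]] := homog_seq y.
apply: sub_finite_set (finite_seq [seq d - k | k <- s]) => h [x Uhx xy].
apply/mapP; apply: contrapT => ns; apply: xy.
rewrite yE form_sumr big_seq big1 // => k sk; apply: contrapT => xk.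
apply: ns; exists k => //; rewrite -(deg h k _ _ Uhx _ xk) ?addrK //.
by split; [exact: Wh|exact: homog_in].
Qed.

(** A functional concentrated in degree [k] is represented by a homogeneous
    vector: the component of degree [d - k] of any vector representing it. *)
Lemma represent_homogeneous U W d k f :
  graded_subspace U -> graded_subspace W -> form_of_degree G U W d ->
  induces_bijection G U W ->
  (forall c x y, U x -> U y -> f (c *: x + y) = c * f x + f y) ->
  (forall h x, degree_part U h x -> h <> k -> f x = 0) ->
  exists2 y, degree_part W (d - k) y & forall x, U x -> G x y = f x.
Proof.
move=> /graded_subspaceP[subU Uh] /graded_subspaceP[_ Wh] deg [_ bij] f_lin f_k.
have [|y0 [[Wy0 y0E] _]] := bij f.
  split=> //; apply: sub_finite_set (finite_set1 k) => h [x Uhx fx] /=.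
  by apply: contrapT => hk; apply: fx; exact: f_k Uhx hk.
have Whom m : degree_part W m (homog y0 m).
  by split; [exact: Wh|exact: homog_in].
exists (homog y0 (d - k)); first exact: Whom.
have hom h x : degree_part U h x -> G x (homog y0 (d - k)) = f x.
  move=> Uhx; have [hk|hk] := pselect (h = k); last first.
    rewrite (f_k h x Uhx hk); apply: contrapT => xy; apply: hk.
    by apply: (addIr (d - k)); rewrite (deg _ _ _ _ Uhx (Whom _) xy) addrC subrK.
  rewrite -y0E; last by case: Uhx.
  apply/esym/form_homogr => m mk; apply: contrapT => xy; apply: mk.
  by rewrite -(deg _ _ _ _ Uhx (Whom _) xy) hk addrAC subrr add0r.
move=> x Ux; have [s _ [_ xE]] := homog_seq x.
have Uhom m : degree_part U m (homog x m).
  by split; [exact: Uh|exact: homog_in].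
rewrite xE form_suml (functional_sum subU f_lin); last by move=> h _; case: (Uhom h).
by apply: eq_bigr => h _; exact: (hom h).
Qed.

End Bilinear.
End GradedForms.

(** * The socle under a graded Nakayama form *)

Section Nakayama.
Set Implicit Arguments.
Unset Strict Implicit.
Context {K : fieldType} {H : zmodType} {A : graded_algebra K H}.
Context {I : choiceType} {e : I -> A} (e_wb : weakly_basic_family e).
Implicit Types (x y z : A) (i j : I) (h k : H).

Local Notation "x ** y" := (gr_mul A x y) (at level 40, left associativity).
Local Notation Soc := (graded_socle A).
Local Notation "A_[ i , h , j ]" := (peirce (e i) h (e j)).
Local Notation "A_[ i , j ]" := (bipeirce (e i) (e j)).

Lemma bipeirce_graded i j : graded_subspace A_[i, j].
Proof.
apply/graded_subspaceP; split; first exact: bipeirce_subspace.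
move=> x h ix; apply: (@peirce_bipeirce _ _ _ _ h).
by apply: bipeirce_homog ix; exact: (wb_deg0 e_wb).
Qed.

Lemma wb_bipeirce_homog i j h x : A_[i, j] x -> A_[i, h, j] (homog x h).
Proof. by apply: bipeirce_homog; exact: (wb_deg0 e_wb). Qed.

Lemma degree_part_socleE i h x :
  degree_part (mulset_l (e i) Soc) h x <-> [/\ Soc x, e i ** x = x & gr_comp A h x].
Proof.
split=> [[/(mulset_lE (wb_idem e_wb i))[|ex Sx] hx]|[Sx ex hx]].
- by move=> y; exact: socle_mul.
- by split.
- split => //; apply/(mulset_lE (wb_idem e_wb i)) => // y; exact: socle_mul.
Qed.

Definition nakayama_data (nu : I -> I) (hh : I -> H) (N : A -> A -> K) : Prop :=
  [/\ forall a b c, N (a ** b) c = N a (b ** c),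
      forall i j x y, e i ** x = x -> y ** e j = y -> N x y <> 0 -> j = nu i,
      bijective nu
    & forall i j, form_of_degree N A_[i, j] A_[j, nu i] (hh i) /\
                  form_nondegenerate N A_[i, j] A_[j, nu i]].

Lemma nakayama_form_data nu N : graded_nakayama_form_with e nu N ->
  exists hh, nakayama_data nu hh N.
Proof.
case=> assoc nz nu_bij [hh hhP]; exists hh; split => //.
  move=> i j x y ex ye xy; apply/nz; exists x, y; split => //.
    by apply/(mulset_lTE (wb_idem e_wb i)).
  by apply/(mulset_rTE (wb_idem e_wb j)).
move=> i j; have := hhP i j.
by rewrite !cornerTE //; exact: (wb_idem e_wb).
Qed.

Context {nu : I -> I} {hh : I -> H} {N : {biscalar A}}.
Context (nak : nakayama_data nu hh N).

Let Nbil := biscalar_bilinear N.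

Lemma nak_assoc a b c : N (a ** b) c = N a (b ** c).
Proof. by case: nak. Qed.

Lemma nak_unit i x y : e i ** x = x -> N x y = N (e i) (x ** y).
Proof. by move=> ex; rewrite -nak_assoc ex. Qed.

Lemma nak_degree i j h k x y : A_[i, h, j] x -> A_[j, k, nu i] y ->
  N x y <> 0 -> h + k = hh i.
Proof.
case: nak => _ _ _ /(_ i j)[deg _] ix jy; apply: deg.
  by split; [exact: peirce_bipeirce ix|case: ix].
by split; [exact: peirce_bipeirce jy|case: jy].
Qed.

Lemma nak_nondegenerate i j y : A_[j, nu i] y -> y <> 0 ->
  exists h x, A_[i, h, j] x /\ N x y <> 0.
Proof.
move=> jy y0; apply: contrapT => /forallNP nx; apply: y0.
have Nxy x : A_[i, j] x -> N x y = 0.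
  move=> ix; have [s _ [_ ->]] := homog_seq x; rewrite (form_suml Nbil) big1 //.
  move=> h _; apply: contrapT => xy; apply: (nx h); exists (homog x h).
  by split => //; exact: wb_bipeirce_homog.
case: nak => _ _ _ /(_ i j)[_ [[_ bij] _]].
have [|z [_ zuniq]] := bij (fun=> 0).
  split; first by move=> *; rewrite mulr0 addr0.
  by apply: sub_finite_set (finite_set1 0) => h [].
rewrite -(zuniq y) ?(zuniq 0) //; split => // [|x _].
  by case: (bipeirce_subspace (e j) (e (nu i))).
exact: form_0r.
Qed.

(** If [x e_j] is nonzero, write [j = nu l]: some [y] in [e_l A e_i] pairs
    nontrivially with [x e_j], hence acts nontrivially on the socle, and
    weak basicness forces [l = i]. *)
Lemma socle_right i x : Soc x -> e i ** x = x -> x ** e (nu i) = x.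
Proof.
move=> Sx ex; apply: contrapT => xnu.
have [j xj] : exists j, (x - x ** e (nu i)) ** e j <> 0.
  by apply: (wb_right_neq0 e_wb) => /subr0_eq x_eq; apply: xnu.
have j_nu : j <> nu i.
  by move=> jE; apply: xj; rewrite jE gr_mulBl -gr_mulA wb_idem // subrr.
have {}xj : x ** e j <> 0.
  move=> xj0; apply: xj; rewrite gr_mulBl xj0 -gr_mulA wb_orth ?gr_mul0r ?subrr //.
  by move=> /esym.
have [_ _ [g gK Kg] _] := nak.
have jx : A_[i, nu (g j)] (x ** e j).
  by rewrite Kg; split; rewrite ?gr_mulA ?ex // -gr_mulA wb_idem.
have [h [y [iy yx]]] := nak_nondegenerate jx xj.
have [ji _] : g j = i /\ exists z, [/\ A_[i, - h, i] z, z ** y = e i & y ** z = e i].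
  apply: (socle_invertible e_wb iy Sx) => yx0; apply: yx.
  by case: iy => ey _ _; rewrite (nak_unit _ ey) gr_mulA yx0 gr_mul0l (form_0r Nbil).
by apply: j_nu; rewrite -ji Kg.
Qed.

Lemma socle_peirce i h x : Soc x -> e i ** x = x -> gr_comp A h x ->
  A_[i, h, nu i] x.
Proof. by move=> Sx ex hx; split => //; exact: socle_right. Qed.

(** The element that pairs nontrivially with [x], given by nondegeneracy, is
    invertible because it acts nontrivially on the socle. *)
Lemma socle_dual i h x : Soc x -> e i ** x = x -> gr_comp A h x -> x <> 0 ->
  exists y, [/\ A_[i, hh i - h, i] y, N y x <> 0
    & exists z, [/\ A_[i, h - hh i, i] z, z ** y = e i & y ** z = e i]].
Proof.
move=> Sx ex hx x0; have ix := socle_peirce Sx ex hx.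
have [k [y [iy yx]]] := nak_nondegenerate (peirce_bipeirce ix) x0.
have kE : k = hh i - h by rewrite -(nak_degree iy ix yx) addrK.
exists y; split => //; first by rewrite -kE.
have [_ [z]] : i = i /\ exists z, [/\ A_[i, - k, i] z, z ** y = e i & y ** z = e i].
  apply: (socle_invertible e_wb iy Sx) => yx0; apply: yx.
  by case: iy => ey _ _; rewrite (nak_unit _ ey) yx0 (form_0r Nbil).
by rewrite kE opprB; exists z.
Qed.

Context (A_split : split_algebra A).

(** Since [A] is split, [e_i A_0 e_i] is spanned by [e_i] and by its radical,
    which kills the socle: pairing with [e_i] alone detects the elements of
    [e_i Soc] of degree [hh i]. *)
Lemma socle_unit_inj i x : Soc x -> e i ** x = x -> gr_comp A (hh i) x ->
  N (e i) x = 0 -> x = 0.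
Proof.
move=> Sx ex hx Nx; apply: contrapT => x0.
have [y [iy yx _]] := socle_dual Sx ex hx x0; rewrite subrr in iy.
have [c radc] := split_residue A_split e_wb iy.
have [_ radR _ _ _] := local_radicalP e_wb i; have [er _ _] := radR _ radc.
apply: yx; rewrite -(subrK (c *: e i) y) (form_addl Nbil) (nak_unit _ er).
rewrite (local_radical_socle radc Sx) (form_0r Nbil) add0r.
by rewrite linearZl_LR /= Nx mulr0.
Qed.

(** The socle element is the one that represents the residue map
    [e_i A_0 e_i -> K], extended by zero to the other degrees. *)
Lemma exists_socle i : exists u,
  [/\ Soc u, e i ** u = u, gr_comp A (hh i) u & N (e i) u = 1].
Proof.
have [rho [rho_lin rho1 rho0]] := residue_functional A_split e_wb i.
have [_ _ _ /(_ i i)[deg [bij _]]] := nak.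
have i0 x : A_[i, i] x -> A_[i, 0, i] (homog x 0) by exact: wb_bipeirce_homog.
have [|h x [ix hx] h0|u [[eu uu] du] uE] := @represent_homogeneous _ _ _ _ Nbil
    _ _ _ 0 (fun x => rho (homog x 0))
    (bipeirce_graded i i) (bipeirce_graded i (nu i)) deg bij.
- by move=> c x y ix iy; rewrite homog_linear rho_lin //; exact: i0.
- rewrite (homog_eq0 hx h0) -[0](homog0 0); apply: rho0.
    by rewrite homog0; exact: subspace0 (peirce_subspace _ _ _).
  rewrite homog0; have [subrad _ _ _ _] := local_radicalP e_wb i.
  exact: subspace0.
rewrite subr0 in du.
exists u; split => //; last first.
  rewrite uE; first by rewrite (homog_id (wb_deg0 e_wb i)).
  exact: wb_bipeirce_id.
apply: (recoverable_socle e_wb eu du) => j k y jy yu.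
have yu_in : A_[j, nu i] (y ** u).
  exact: (bipeirce_mul (peirce_bipeirce jy) (conj eu uu)).
have [h [b [ib bE]]] := nak_nondegenerate yu_in yu.
have iby : A_[i, h + k, i] (b ** y) by exact: (peirce_mul ib jy).
have rby : rho (homog (b ** y) 0) <> 0.
  by rewrite -uE ?nak_assoc //; exact: peirce_bipeirce iby.
have hk : h + k = 0.
  apply: (addIr (hh i)); rewrite add0r; apply: (nak_degree iby (y := u)) => //.
  by rewrite nak_assoc.
rewrite hk in iby; have [_ _ by0] := iby; rewrite (homog_id by0) in rby.
have [_ _ _ _ rad_inv] := local_radicalP e_wb i.
have [|z _ zE] := rad_inv _ iby; first by move=> /(rho0 _ iby).
by exists (z ** b); rewrite -gr_mulA [b ** _]gr_mulA gr_mulA zE.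
Qed.

(** Multiplication by an invertible element of degree [hh i - h] carries
    [e_i Soc_h] into [e_i Soc_(hh i)], where pairing with [e_i] is injective. *)
Lemma socle_dim1 i h x0 x : Soc x0 -> e i ** x0 = x0 -> gr_comp A h x0 ->
  x0 <> 0 -> Soc x -> e i ** x = x -> gr_comp A h x -> exists c, x = c *: x0.
Proof.
move=> Sx0 ex0 hx0 x00 Sx ex hx.
have [y [iy yx0 [z [_ zy _]]]] := socle_dual Sx0 ex0 hx0 x00.
exists (N y x / N y x0); apply: subr0_eq; set u := x - _.
have Su : Soc u by apply: subspaceB => //; [exact: socle_subspace|
  apply: subspaceZ => //; exact: socle_subspace].
have eu : e i ** u = u by rewrite gr_mulBr gr_mulZr ex ex0.
have hu : gr_comp A h u.
  apply: subspaceB => //; first exact: gr_comp_subspace.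
  by apply: subspaceZ => //; exact: gr_comp_subspace.
have [ey _ dy] := iy.
rewrite -[LHS]eu -zy -gr_mulA (@socle_unit_inj i (y ** u)) ?gr_mul0r //.
- exact: socle_mul.
- by rewrite gr_mulA ey.
- by apply: (gr_mul_comp dy hu); rewrite subrK.
rewrite -(nak_unit _ ey) linearBr linearZr_LR /= divfK ?subrr //; exact/eqP.
Qed.

Lemma socle_has_dim1 i h : gr_support (mulset_l (e i) Soc) h ->
  has_dim (degree_part (mulset_l (e i) Soc) h) 1.
Proof.
case=> x0 /degree_part_socleE[Sx0 ex0 hx0] x00; exists [:: x0] => //; split => //.
- move=> x; rewrite degree_part_socleE; split.
    case=> Sx ex hx; have [c ->] := socle_dim1 Sx0 ex0 hx0 x00 Sx ex hx.
    by exists (fun=> c); rewrite big_seq1.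
  case=> c ->; rewrite big_seq1 gr_mulZr ex0; split => //.
    by apply: subspaceZ => //; exact: socle_subspace.
  by apply: subspaceZ => //; exact: gr_comp_subspace.
- move=> c; rewrite big_seq1 => /eqP; rewrite scaler_eq0 => /orP[/eqP c0 b|/eqP //].
  by rewrite inE => /eqP ->.
Qed.

End Nakayama.
Arguments nakayama_data {K H A I} e nu hh N.

(** * Bases with a prescribed coefficient functional *)

Section Bases.
Set Implicit Arguments.
Unset Strict Implicit.
Context {K : fieldType} {V : lmodType K}.
Implicit Types (U : set V) (B : seq V) (b w x : V) (c : V -> K).

Definition span B : set V :=
  [set x | exists c : V -> K, x = \sum_(b <- B) c b *: b].

Lemma span_subspace B : subspace (span B).
Proof.
split; first by exists (fun=> 0); rewrite big1 // => b _; rewrite scale0r.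
move=> k _ _ [c ->] [d ->]; exists (fun b => k * c b + d b).
rewrite scaler_sumr -big_split; apply: eq_bigr => b _.
by rewrite scalerDl scalerA.
Qed.

Lemma sum_delta B b : uniq B -> b \in B ->
  \sum_(a <- B) (a == b)%:R *: a = b.
Proof.
move=> uB Bb; rewrite (bigD1_seq b) //= eqxx scale1r big1 ?addr0 // => a /negPf ->.
by rewrite scale0r.
Qed.

Lemma mem_span B b : uniq B -> b \in B -> span B b.
Proof. by move=> uB Bb; exists (fun a => (a == b)%:R); rewrite sum_delta. Qed.

Lemma span_min U B : subspace U -> (forall b, b \in B -> U b) -> span B `<=` U.
Proof.
move=> subU BU _ [c ->]; apply: subspace_sum => // b Bb.
by apply: subspaceZ => //; apply: BU.
Qed.

Lemma basis_mem U B b : is_basis U B -> b \in B -> U b.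
Proof. by case=> uB UE _ Bb; apply/UE; exact: mem_span. Qed.

Lemma basis_uniq U B c d : is_basis U B ->
  \sum_(b <- B) c b *: b = \sum_(b <- B) d b *: b ->
  forall b, b \in B -> c b = d b.
Proof.
case=> _ _ indep cd b Bb; apply: subr0_eq.
apply: (indep (fun b => c b - d b)) => //.
under eq_bigr do rewrite scalerBl.
by rewrite big_split /= sumrN cd subrr.
Qed.

Lemma basis_neq0 U B b : is_basis U B -> b \in B -> b <> 0.
Proof.
move=> [_ _ indep] Bb b0; have := @indep (fun a => (a == 0)%:R).
rewrite big1 => [/(_ erefl b Bb)/eqP|a _]; first by rewrite b0 eqxx oner_eq0.
by case: eqP => [->|_]; rewrite ?scaler0 ?scale0r.
Qed.

Lemma coefficient_uniq U B w x k l : is_basis U B -> w \in B ->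
  is_coefficient B w x k -> is_coefficient B w x l -> k = l.
Proof. by move=> UB Bw [c -> ->] [d cd ->]; exact: basis_uniq UB cd w Bw. Qed.

(** Exchange [w] for some [b0] that occurs in its expansion, then move each
    other [b] into the kernel of [f] along [w]: any functional [f] with [f w = 1] is
    the coefficient of [w] in a suitable basis. *)
Lemma basis_for_functional U B w (f : V -> K) : is_basis U B -> U w ->
  (forall (k : K) x y, U x -> U y -> f (k *: x + y) = k * f x + f y) -> f w = 1 ->
  exists B', [/\ is_basis U B', w \in B' & forall b, b \in B' -> b <> w -> f b = 0].
Proof.
move=> UB Uw f_lin fw; have [uB UE indep] := UB.
have subU : subspace U.
  have [S0 SL] := span_subspace B; split; first exact/UE.
  by move=> k x y /UE Ux /UE Uy; apply/UE; apply: SL.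
have f0 : f 0 = 0 by exact: (functional0 subU).
have [c0 wE] := (UE w).1 Uw.
have [b0 Bb0 cb0] : exists2 b0, b0 \in B & c0 b0 != 0.
  apply: contrapT => h; have /eqP := fw.
  rewrite wE big_seq big1 ?f0 ?(eq_sym 0) ?oner_eq0 // => b Bb.
  have [->|cb] := eqVneq (c0 b) 0; first by rewrite scale0r.
  by exfalso; apply: h; exists b.
pose T b := b - f b *: w; pose s := rem b0 B.
have sB b : b \in s -> b \in B by exact: mem_rem.
have sb0 b : b \in s -> b != b0 by rewrite mem_rem_uniq // => /andP[].
have sumB c : \sum_(b <- B) c b *: b = c b0 *: b0 + \sum_(b <- s) c b *: b.
  by rewrite (perm_big _ (perm_to_rem Bb0)) big_cons.
have fT b : U b -> f (T b) = 0.
  move=> Ub; rewrite /T addrC -scaleNr f_lin // fw mulr1 addNr //.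
have UT b : U b -> U (T b).
  by move=> Ub; apply: (subspaceB subU Ub); exact: subspaceZ.
have Us b : b \in s -> U b by move=> /sB; exact: basis_mem UB.
(* A combination of [s] that is a multiple of [w] is zero, since [b0] occurs in
   [w] and not in [s]. *)
have indep_s d k : \sum_(b <- s) d b *: b = k *: w ->
    k = 0 /\ forall b, b \in s -> d b = 0.
  move=> dk; have eq0 : \sum_(b <- B)
      ((if b == b0 then 0 else d b) - k * c0 b) *: b = 0.
    under eq_bigr do rewrite scalerBl -scalerA.
    rewrite big_split /= sumrN -scaler_sumr -wE -dk.
    rewrite (sumB (fun b => if b == b0 then 0 else d b)) eqxx scale0r add0r.
    apply/eqP; rewrite subr_eq0; apply/eqP; rewrite big_seq [RHS]big_seq.
    by apply: eq_bigr => b /sb0 /negPf ->.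
  have k0 : k = 0.
    have /eqP := indep _ eq0 b0 Bb0.
    by rewrite eqxx sub0r oppr_eq0 mulf_eq0 (negPf cb0) orbF => /eqP.
  split => // b sb; have := indep _ eq0 b (sB b sb).
  by rewrite (negPf (sb0 b sb)) k0 mul0r subr0.
have us : uniq s by exact: rem_uniq.
have T_inj : {in s &, injective T}.
  move=> b b' sb sb' TT.
  have [] := indep_s (fun a => (a == b)%:R - (a == b')%:R) (f b - f b').
    under eq_bigr do rewrite scalerBl.
    rewrite big_split /= sumrN !sum_delta // scalerBl.
    have {}TT : b - f b *: w = b' - f b' *: w := TT.
    apply: subr0_eq; rewrite opprB [f b' *: w - _]addrC addrACA [- b' + _]addrC.
    by rewrite -[X in _ + X]opprB TT subrr.
  move=> _ /(_ b sb)/eqP; rewrite eqxx subr_eq0.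
  by case: (b =P b') => //= _; rewrite oner_eq0.
have w_neq b : b \in s -> w <> T b.
  move=> sb wT; have /eqP := fw.
  by rewrite wT fT ?(eq_sym 0) ?oner_eq0 //; exact: Us.
pose B' := w :: [seq T b | b <- s].
have uB' : uniq B'.
  rewrite /= map_inj_in_uniq // us andbT; apply/negP => /mapP[b sb].
  exact: w_neq.
have spw : span B' w by apply: mem_span => //; rewrite inE eqxx.
have sps b : b \in s -> span B' b.
  move=> sb; rewrite -(subrK (f b *: w) b).
  apply: (subspaceD (span_subspace B')); last exact: subspaceZ (span_subspace B') _ _ spw.
  have : T b \in B' by rewrite inE map_f ?orbT.
  exact: mem_span.
have sp0 : span B' b0.
  have -> : b0 = (c0 b0)^-1 *: (w - \sum_(b <- s) c0 b *: b).
    by rewrite [in RHS]wE sumB addrK scalerA mulVf // scale1r.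
  apply: subspaceZ; first exact: span_subspace.
  apply: subspaceB => //; first exact: span_subspace.
  apply: subspace_sum; first exact: span_subspace.
  by move=> b sb; apply: subspaceZ; [exact: span_subspace|exact: sps].
exists B'; split; last 1 first.
- move=> b; rewrite inE => /orP[/eqP -> //|/mapP[a sa ->] _].
  by apply: fT; exact: Us.
- split => //.
  + move=> x; split; last first.
      apply: span_min => // b; rewrite inE => /orP[/eqP -> //|/mapP[a sa ->]].
      by apply: UT; exact: Us.
    move/UE; apply: (@span_min (span B') B (span_subspace B')) => b.
    have [-> //|bb0] := eqVneq b b0.
    by move=> Bb; apply: sps; rewrite mem_rem_uniq // inE bb0.
  + move=> c; rewrite big_cons big_map => c_0.
    have cw : c w = 0.
      rewrite -f0 -c_0 f_lin //; last first.
        by apply: subspace_sum => // b sb; apply: subspaceZ => //; apply: UT; exact: Us.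
      rewrite fw mulr1 (functional_sum subU f_lin).
        rewrite big_seq big1 ?addr0 // => b sb.
        rewrite -[_ *: _]addr0 f_lin ?fT ?mulr0 ?add0r //; first exact: Us.
          by apply: UT; exact: Us.
        exact: subspace0.
      by move=> b sb; apply: subspaceZ => //; apply: UT; exact: Us.
    move: c_0; rewrite cw scale0r add0r => c_0.
    have [|_ c_s] := indep_s (fun b => c (T b)) (\sum_(b <- s) c (T b) * f b).
      rewrite scaler_suml; apply: subr0_eq; rewrite -sumrB -[RHS]c_0.
      by apply: eq_bigr => b _; rewrite scalerBr scalerA.
    by move=> b; rewrite inE => /orP[/eqP -> //|/mapP[a sa ->]]; exact: c_s.
- by rewrite inE eqxx.
Qed.

End Bases.

(** * Nakayama forms and coefficients of socle elements *)

Section Comparison.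
Set Implicit Arguments.
Unset Strict Implicit.
Context {K : fieldType} {H : zmodType} {A : graded_algebra K H}.
Context {I : choiceType} {e : I -> A} (e_wb : weakly_basic_family e).
Context (A_split : split_algebra A).
Implicit Types (x y z : A) (i j : I) (h k : H).

Local Notation "x ** y" := (gr_mul A x y) (at level 40, left associativity).
Local Notation Soc := (graded_socle A).
Local Notation "A_[ i , h , j ]" := (peirce (e i) h (e j)).
Local Notation "A_[ i , j ]" := (bipeirce (e i) (e j)).

(** [e_i Soc] is nonzero, and any graded Nakayama form places it in
    [A e_(nu i)]. *)
Lemma nakayama_permutation_unique nu nu' hh hh' (N N' : {biscalar A}) :
  nakayama_data e nu hh N -> nakayama_data e nu' hh' N' -> nu = nu'.
Proof.
move=> nak nak'; apply: funext => i; apply: contrapT => nui.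
have [u [Su eu _ Nu]] := exists_socle e_wb nak' A_split i.
have u1 := socle_right e_wb nak Su eu.
have u2 := socle_right e_wb nak' Su eu.
have u0 : u = 0 by rewrite -u2 -u1 -gr_mulA (wb_orth e_wb nui) gr_mul0r.
by move: Nu; rewrite u0 linear0r => /esym/eqP; rewrite oner_eq0.
Qed.

(** [F] is the form that reads off the coefficients of the socle elements [w_i] in
    the bases [B_i], extended by zero outside of the matching degrees. *)
Definition coefficient_form (nu : I -> I) (F : A -> A -> K)
    (hh : I -> H) (B : I -> seq A) (w : I -> A) : Prop :=
  [/\ forall i, gr_support (mulset_l (e i) Soc) (hh i),
      forall i, is_basis A_[i, hh i, nu i] (B i),
      forall i, unique (fun b => b \in B i /\
                  degree_part (mulset_l (e i) Soc) (hh i) b) (w i),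
      forall i j h k a b, e i ** a = a -> gr_comp A h a ->
        b ** e j = b -> gr_comp A k b ->
        ~ (j = nu i /\ h + k = hh i) -> F a b = 0
    & forall i h a b, e i ** a = a -> gr_comp A h a ->
        b ** e (nu i) = b -> gr_comp A (hh i - h) b ->
        is_coefficient (B i) (w i) (a ** b) (F a b)].

(** Take [w_i] in the socle with [F (e_i, w_i) = 1] and complete it by a basis of
    the kernel of [F (e_i, -)]: the coefficient of [w_i] in [a b] is then
    [F (e_i, a b) = F (a, b)]. *)
Lemma nakayama_coefficient_form nu hh (F : {biscalar A}) :
  nakayama_data e nu hh F -> exists B w, coefficient_form nu F hh B w.
Proof.
move=> nak; have Fbil := biscalar_bilinear F.
have /choice[w wP] := exists_socle e_wb nak A_split.
have wR i : A_[i, hh i, nu i] (w i).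
  by have [Sw ew hw _] := wP i; exact: (socle_peirce e_wb nak Sw ew hw).
have /choice[B BP] i : exists B, [/\ is_basis A_[i, hh i, nu i] B, w i \in B
    & forall b, b \in B -> b <> w i -> F (e i) b = 0].
  have [_ lfd _ _] := e_wb; have [n [B0]] := lfd i (nu i) (hh i).
  rewrite (corner_compE (wb_idem e_wb i) (wb_idem e_wb _) (wb_deg0 e_wb i)) //;
    last exact: wb_deg0.
  move=> B0_basis _.
  apply: (basis_for_functional B0_basis (wR i)); last by case: (wP i).
  by move=> k x y _ _; case: Fbil => _ Fr; exact: Fr.
exists B, w; split.
- move=> i; have [Sw ew hw Fw] := wP i; exists (w i).
    exact/(degree_part_socleE e_wb).
  by move=> w0; move: Fw; rewrite w0 linear0r => /esym/eqP; rewrite oner_eq0.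
- by move=> i; case: (BP i).
- move=> i; have [Bbasis Bw Bker] := BP i; have [Sw ew hw Fw] := wP i; split.
    by split => //; exact/(degree_part_socleE e_wb).
  move=> b [Bb /(degree_part_socleE e_wb)[Sb eb hb]]; apply: contrapT => wb.
  apply: (basis_neq0 Bbasis Bb).
  by apply: (socle_unit_inj e_wb nak A_split Sb eb hb); apply: Bker => // /esym.
- move=> i j h k a b ea ha be kb; apply: contra_notP => Fab.
  have [_ nz _ _] := nak; have jE : j = nu i := nz i j a b ea be Fab.
  split=> //; have iab : A_[i, h + k, nu i] (a ** b).
    by split; rewrite ?gr_mulA ?ea // -?gr_mulA -?jE ?be //; exact: gr_comp_mul.
  rewrite -[h + k]add0r; apply: (nak_degree nak (wb_peirce_id e_wb i) iab).
  by rewrite -(nak_unit nak).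
- move=> i h a b ea ha be kb; have [Bbasis Bw Bker] := BP i.
  have [uB BE _] := Bbasis; have [_ _ _ Fw] := wP i.
  have /BE[c cE] : A_[i, hh i, nu i] (a ** b).
    split; rewrite ?gr_mulA ?ea // -?gr_mulA ?be //.
    by apply: (gr_mul_comp ha kb); rewrite addrC subrK.
  exists c => //; rewrite (nak_unit nak b ea) cE (form_sumr Fbil).
  rewrite (bigD1_seq (w i)) //= linearZr_LR /= Fw mulr1.
  rewrite big_seq_cond big1 ?addr0 // => b' /andP[Bb' /eqP b'w].
  by rewrite linearZr_LR /= Bker ?mulr0.
Qed.

(** If [F x y = N (p x) y] with [p] homogeneous and invertible, then [F]
    inherits both bijections of nondegeneracy from [N], because [x |-> p x] is a
    bijection of [e_i A e_j] that shifts degrees by [q]. *)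
Lemma twist_nondegenerate (F N : {biscalar A}) i j m q d p z :
  A_[i, q, i] p -> A_[i, - q, i] z -> z ** p = e i -> p ** z = e i ->
  (forall x y, A_[i, j] x -> A_[j, m] y -> F x y = N (p ** x) y) ->
  form_of_degree F A_[i, j] A_[j, m] d ->
  form_nondegenerate N A_[i, j] A_[j, m] ->
  form_nondegenerate F A_[i, j] A_[j, m].
Proof.
move=> ip iz zp pz FN degF [[_ bijl] [_ bijr]].
have Fbil := biscalar_bilinear F.
have px x : A_[i, j] x -> A_[i, j] (p ** x).
  by move=> ix; exact: (bipeirce_mul (peirce_bipeirce ip) ix).
have zx x : A_[i, j] x -> A_[i, j] (z ** x).
  by move=> ix; exact: (bipeirce_mul (peirce_bipeirce iz) ix).
have pzx x : A_[i, j] x -> p ** (z ** x) = x.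
  by case=> ex _; rewrite gr_mulA pz.
have zpx x : A_[i, j] x -> z ** (p ** x) = x.
  by case=> ex _; rewrite gr_mulA zp.
split; split.
- exact: (form_graded_dual Fbil (bipeirce_graded e_wb _ _) degF).
- move=> f [f_lin f_fin]; have [|y [[jy yE] yuniq]] := bijl (fun x => f (z ** x)).
    split; first by move=> c x y ix iy; rewrite gr_mulDr gr_mulZr f_lin //; exact: zx.
    apply: sub_finite_set (finite_image (fun k => k + q) f_fin).
    move=> h [x [ix hx] fzx]; exists (h - q); last by rewrite subrK.
    exists (z ** x) => //; split; first exact: zx.
    by case: iz => _ _ dz; apply: (gr_mul_comp dz hx); rewrite addrC.
  exists y; split; first by split => // x ix; rewrite FN // yE ?zpx //; exact: px.
  move=> y' [jy' y'E]; apply: yuniq; split => // x ix.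
  by rewrite -y'E; [rewrite FN ?pzx //; exact: zx|exact: zx].
- apply: (form_graded_dual (bilinear_form_tr Fbil) (bipeirce_graded e_wb i j) (d := d)).
  by move=> h k y x jy ix xy; rewrite addrC; exact: (degF _ _ _ _ ix jy xy).
- move=> f f_dual; have [x0 [[ix0 x0E] x0uniq]] := bijr f f_dual.
  exists (z ** x0); split.
    split; first exact: zx.
    by move=> y jy; rewrite FN ?pzx ?x0E //; exact: zx.
  move=> x [ix xE]; rewrite (x0uniq (p ** x)) ?zpx //; split; first exact: px.
  by move=> y jy; rewrite -FN ?xE.
Qed.

Section CoefficientForms.
Context {nu : I -> I} {hh0 : I -> H} {N : {biscalar A}}.
Context (nak : nakayama_data e nu hh0 N).
Context {F : {biscalar A}} {hh : I -> H} {B : I -> seq A} {w : I -> A}.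
Context (FB : coefficient_form nu F hh B w).

Let Fbil := biscalar_bilinear F.
Let Nbil := biscalar_bilinear N.

Lemma coefficient_w i : [/\ w i \in B i, Soc (w i), e i ** w i = w i,
  A_[i, hh i, nu i] (w i) & F (e i) (w i) = 1].
Proof.
have [_ /(_ i) Bbasis /(_ i)[[Bw Sw] _] _ Fcoef] := FB.
have /(degree_part_socleE e_wb)[{}Sw ew hw] := Sw.
have iw := basis_mem Bbasis Bw; split => //.
apply: (coefficient_uniq Bbasis Bw (x := w i)).
  rewrite -{2}ew; apply: (Fcoef i 0) => //; rewrite ?(wb_idem e_wb) ?subr0 //.
    exact: wb_deg0.
  by case: iw.
exists (fun a => (a == w i)%:R); last by rewrite eqxx.
by rewrite sum_delta //; case: Bbasis.
Qed.

(** For homogeneous [a], [b], [c] both sides are the coefficient of [w_i] in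
    [a b c], or both vanish for reasons of degree and position; the general case
    follows by expanding [a], [b] and [c] into homogeneous pieces. *)
Lemma coefficient_assoc a b c : F (a ** b) c = F a (b ** c).
Proof.
have [_ Bbasis Bw Fzero Fcoef] := FB.
have hom i j h k l x y z : e i ** x = x -> gr_comp A h x -> gr_comp A k y ->
    z ** e j = z -> gr_comp A l z -> F (x ** y) z = F x (y ** z).
  move=> ex hx ky ze lz.
  have exy : e i ** (x ** y) = x ** y by rewrite gr_mulA ex.
  have yze : (y ** z) ** e j = y ** z by rewrite -gr_mulA ze.
  have hxy := gr_comp_mul hx ky; have hyz := gr_comp_mul ky lz.
  have [[jE hE]|ne] := pselect (j = nu i /\ h + k + l = hh i); last first.
    rewrite (Fzero i j _ _ _ _ exy hxy ze lz ne).
    by rewrite (Fzero i j _ _ _ _ ex hx yze hyz) // addrA.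
  subst j; have [Bwi _ _ _ _] := coefficient_w i.
  apply: (coefficient_uniq (Bbasis i) Bwi (x := x ** y ** z)).
    by apply: (Fcoef i _ _ _ exy hxy ze); rewrite -hE addrAC subrr add0r.
  rewrite -gr_mulA; apply: (Fcoef i _ _ _ ex hx yze).
  by rewrite -hE -[h + k + l]addrA [h + (k + l)]addrC addrK.
have [sa aE] := wb_left_sum e_wb a.
rewrite aE gr_mul_suml !(form_suml Fbil); apply: eq_bigr => i _.
set x := e i ** a; have ex : e i ** x = x by rewrite gr_mulA wb_idem.
have [sx _ [_ xE]] := homog_seq x.
rewrite xE gr_mul_suml !(form_suml Fbil); apply: eq_bigr => h _.
have exh : e i ** homog x h = homog x h.
  by rewrite -[in RHS]ex (homog_mull _ (wb_deg0 e_wb i)) subr0.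
have [sb _ [_ bE]] := homog_seq b.
rewrite bE gr_mul_sumr gr_mul_suml (form_suml Fbil) (form_sumr Fbil).
apply: eq_bigr => k _.
have [sc cE] := wb_right_sum e_wb c.
rewrite cE gr_mul_sumr !(form_sumr Fbil); apply: eq_bigr => j _.
set z := c ** e j; have ze : z ** e j = z by rewrite -gr_mulA wb_idem.
have [sz _ [_ zE]] := homog_seq z.
rewrite zE gr_mul_sumr !(form_sumr Fbil); apply: eq_bigr => l _.
have zel : homog z l ** e j = homog z l.
  by rewrite -[in RHS]ze (homog_mulr _ (wb_deg0 e_wb j)) subr0.
exact: (hom i j h k l _ _ _ exh (homog_in _ _) (homog_in _ _) zel (homog_in _ _)).
Qed.

Lemma coefficient_degree i j : form_of_degree F A_[i, j] A_[j, nu i] (hh i).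
Proof.
move=> h k x y [[ex _] hx] [[_ ye] ky]; apply: contra_notP => hk.
have [_ _ _ Fzero _] := FB.
by apply: (Fzero i (nu i) h k) => // -[].
Qed.

(** The functional [F e_i] is represented by the reference form [N] as [N p],
    and [p] is invertible because [p w_i] is nonzero with [w_i] in the socle:
    thus [F] is [N] twisted by [p]. *)
Lemma coefficient_nondegenerate i j : form_nondegenerate F A_[i, j] A_[j, nu i].
Proof.
have [_ Sw _ iw Fw] := coefficient_w i.
have [_ _ _ nak_form] := nak.
have [degN [_ bijN]] := nak_form i i.
have degN' : form_of_degree (fun y x => N x y) A_[i, nu i] A_[i, i] (hh0 i).
  by move=> h k y x iy ix xy; rewrite addrC; exact: (degN _ _ _ _ ix iy xy).
have [_ Fr] := Fbil.
have [|h y iy hk|p [ip dp] pE] := represent_homogeneous (bilinear_form_tr Nbil)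
    (bipeirce_graded e_wb i (nu i)) (bipeirce_graded e_wb i i) degN' bijN
    (k := hh i) (f := F (e i)).
- by move=> c x y _ _; exact: Fr.
- apply: contrapT => Fy; apply: hk; rewrite -[h]add0r.
  apply: (@coefficient_degree i i 0 h (e i) y) => //.
  by split; [exact: wb_bipeirce_id|exact: wb_deg0].
have iqp : A_[i, hh0 i - hh i, i] p by case: ip.
have pw : p ** w i <> 0.
  move=> pw; have := pE _ (peirce_bipeirce iw); rewrite Fw.
  rewrite (nak_unit nak (w i) (x := p) (i := i)); last by case: ip => -[].
  by rewrite pw linear0r => /esym/eqP; rewrite oner_eq0.
have [_ [z [iz zp pz]]] := socle_invertible e_wb iqp Sw pw.
have [_ nondegN] := nak_form i j.
apply: (twist_nondegenerate iqp iz zp pz _ (@coefficient_degree i j) nondegN).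
move=> x y ix jy; have [ex _] := ix.
rewrite (nak_assoc nak) pE; last exact: bipeirce_mul ix jy.
by rewrite -coefficient_assoc ex.
Qed.

Lemma coefficient_nakayama_form : graded_nakayama_form_with e nu F.
Proof.
have [_ _ _ Fzero _] := FB; have [_ _ nu_bij _] := nak.
split => //; first exact: coefficient_assoc.
  move=> i j; split=> [[x [y []]]|->].
    move=> /(mulset_lTE (wb_idem e_wb i)) ex /(mulset_rTE (wb_idem e_wb j)) ye xy.
    have [h xh] := form_neq0_homogr (bilinear_form_tr Fbil) xy.
    have [k xk] := form_neq0_homogr Fbil xh.
    apply: contrapT => jnu; apply: xk; apply: (Fzero i j h k) => [||||[]//].
    - by rewrite -[in RHS]ex (homog_mull _ (wb_deg0 e_wb i)) subr0.
    - exact: homog_in.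
    - by rewrite -[in RHS]ye (homog_mulr _ (wb_deg0 e_wb j)) subr0.
    - exact: homog_in.
  have [_ _ ew [_ we _] Fw] := coefficient_w i.
  exists (e i), (w i); split.
  - by apply/(mulset_lTE (wb_idem e_wb i)); exact: wb_idem.
  - exact/(mulset_rTE (wb_idem e_wb (nu i))).
  - by rewrite Fw => /eqP; rewrite oner_eq0.
exists hh => i j; rewrite !cornerTE; try exact: (wb_idem e_wb).
by split; [exact: coefficient_degree|exact: coefficient_nondegenerate].
Qed.

End CoefficientForms.
End Comparison.

Theorem proposition3p6 (K : fieldType) (H : zmodType) (A : graded_algebra K H)
    (A_pF : graded_pseudo_frobenius A) (A_split : split_algebra A)
    (I : choiceType) (e : I -> A) (e_wb : weakly_basic_family e)
    (nu : I -> I) (nuP : nakayama_permutation e nu) :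
  (forall (i : I) (h : H),
     gr_support (mulset_l (e i) (graded_socle A)) h ->
     has_dim (degree_part (mulset_l (e i) (graded_socle A)) h) 1)
  /\
  (forall form : {biscalar A},
     graded_nakayama_form e form <->
     exists (hh : I -> H) (B : I -> seq A) (w : I -> A),
       [/\ forall i, gr_support (mulset_l (e i) (graded_socle A)) (hh i),
           forall i,
             is_basis (corner (e i) (gr_comp A (hh i)) (e (nu i))) (B i),
           forall i,
             unique (fun b => b \in B i /\
                degree_part (mulset_l (e i) (graded_socle A)) (hh i) b) (w i),
           forall (i j : I) (h k : H) (a b : A),
             mulset_l (e i) (gr_comp A h) a ->
             mulset_r (gr_comp A k) (e j) b ->
             ~ (j = nu i /\ h + k = hh i) -> form a b = 0
         & forall (i : I) (h : H) (a b : A),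
             mulset_l (e i) (gr_comp A h) a ->
             mulset_r (gr_comp A (hh i - h)) (e (nu i)) b ->
             is_coefficient (B i) (w i) (gr_mul A a b) (form a b)]).
Proof.
have [N /(nakayama_form_data e_wb)[hh0 nak]] := nuP.
have lE i := mulset_l_compE (wb_idem e_wb i) (wb_deg0 e_wb i).
have rE i := mulset_r_compE (wb_idem e_wb i) (wb_deg0 e_wb i).
have cE i j := corner_compE (wb_idem e_wb i) (wb_idem e_wb j)
  (wb_deg0 e_wb i) (wb_deg0 e_wb j).
split=> [i h|F]; first exact: (socle_has_dim1 e_wb nak A_split).
split=> [[nu' F_nak]|[hh [B [w [supp basis wB Fzero Fcoef]]]]].
  have [hh nak'] := nakayama_form_data e_wb F_nak.
  have nuE := nakayama_permutation_unique e_wb A_split nak nak'; subst nu'.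
  have [B [w [supp basis wB Fzero Fcoef]]] :=
    nakayama_coefficient_form e_wb A_split nak'.
  exists hh, B, w; split => //.
  - by move=> i; rewrite cE.
  - by move=> i j h k a b /lE[ea ha] /rE[be kb]; exact: (Fzero i j h k).
  - by move=> i h a b /lE[ea ha] /rE[be kb]; exact: (Fcoef i h).
exists nu; apply: (coefficient_nakayama_form e_wb nak (hh := hh) (B := B) (w := w)).
split => //.
- by move=> i; rewrite -cE.
- move=> i j h k a b ea ha be kb.
  by apply: (Fzero i j h k); [exact/lE|exact/rE].
- by move=> i h a b ea ha be kb; apply: (Fcoef i h); [exact/lE|exact/rE].
Qed.
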